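(* Let $\vec{\ell}=(\ell_1,\ldots,\ell_m)$ be an $\mathcal{S}_n$-sequence, let $\vec{i}=(i_1,\ldots,i_m)$ be a $\mathbb{Z}_r$-sequence, and let $\lambda$ be an $r$-partition of size $n$. Then $$\chi_{H_{r,n}}^\lambda\big(T_{\vec{\ell}}^{\vec{i}}\big)=\sum_{\emptyset=\mu^{(0)}\subseteq\mu^{(1)}\subseteq\cdots\subseteq\mu^{(m)}=\lambda}\Delta^{(i_1)}(\mu^{(1)})\,\Delta^{(i_2)}(\mu^{(2)}/\mu^{(1)})\cdots\Delta^{(i_m)}(\mu^{(m)}/\mu^{(m-1)}),$$ where the sum is over all sequences of $r$-partitions $\emptyset=\mu^{(0)}\subseteq\mu^{(1)}\subseteq\cdots\subseteq\mu^{(m)}=\lambda$ such that $|\mu^{(j)}/\mu^{(j-1)}|=\ell_j-\ell_{j-1}$ for $1\le j\le m$, with $\ell_0=0$.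
   Context: Let $r,n$ be positive integers and let $q,u_1,\ldots,u_r$ be indeterminates. $H_{r,n}$ is the associative algebra with $1$ over $\mathbb{C}(u_1,\ldots,u_r,q)$ with generators $T_1,\ldots,T_n$ and relations: $T_iT_j=T_jT_i$ for $|i-j|>1$; $T_iT_{i+1}T_i=T_{i+1}T_iT_{i+1}$ for $2\le i\le n-1$; $T_1T_2T_1T_2=T_2T_1T_2T_1$; $(T_1-u_1)\cdots(T_1-u_r)=0$; $(T_i-q)(T_i+q^{-1})=0$ for $2\le i\le n$. Partitions are identified with Ferrers diagrams, rows and columns labeled as for matrices; position $(i,j)$ means row $i$, column $j$. An $r$-partition of size $n$ is an $r$-tuple $\mu=(\mu^{(1)},\ldots,\mu^{(r)})$ of partitions (the superscripts here index components) of total size $n$; $\nu\subseteq\mu$ means componentwise containment, and then $\mu/\nu$ is the $r$-skew shape with components the skew diagrams $\mu^{(i)}/\nu^{(i)}$. A shape is an $r$-partition or an $r$-skew shape; $|\cdot|$ is its number of boxes. (In the theorem the superscripts $\mu^{(0)},\ldots,\mu^{(m)}$ instead index members of a chain of $r$-partitions.) A standard tableau $L$ of a shape $\lambda$ of size $n$ is a filling of its boxes with $1,\ldots,n$, each once, increasing left to right along rows and down columns of each component; $\mathcal{L}(\lambda)$ is the set of these; $L(k)$ is the box containing $k$. The content of a box $b$ in position $(i,j)$ of the $k$-th component is $\mathrm{ct}(b)=u_kq^{2(j-i)}$. For a standard tableau $L$ of size $n$ put $(T_i)_{LL}=\dfrac{q-q^{-1}}{1-\mathrm{ct}(L(i-1))/\mathrm{ct}(L(i))}$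 for $2\le i\le n$. For an $r$-partition $\lambda$ of size $n$, $V^\lambda$ is the $\mathbb{C}(u_1,\ldots,u_r,q)$-vector space with basis $\{v_L\mid L\in\mathcal{L}(\lambda)\}$, which is an $H_{r,n}$-module via $T_1v_L=\mathrm{ct}(L(1))v_L$ and $T_iv_L=(T_i)_{LL}v_L+(q^{-1}+(T_i)_{LL})v_{s_iL}$ for $2\le i\le n$, where $s_iL$ is $L$ with the positions of $i-1$ and $i$ switched and $v_{s_iL}=0$ if $s_iL$ is not standard. $\chi^\lambda_{H_{r,n}}$ is the character (trace) of $V^\lambda$. Put $t_i=T_iT_{i-1}\cdots T_2T_1T_2\cdots T_{i-1}T_i$. For $1\le k<\ell\le n$ and $0\le i\le r-1$ let $R^{(i)}_{k\ell}=(t_k)^iT_{k+1}T_{k+2}\cdots T_\ell$, and $R^{(i)}_{kk}=(t_k)^i$. An $\mathcal{S}_n$-sequence of length $m$ is $\vec\ell=(\ell_1,\ldots,\ell_m)$ with $1\le\ell_1<\cdots<\ell_m=n$; a $\mathbb{Z}_r$-sequence of length $m$ is $\vec i=(i_1,\ldots,i_m)$ with $0\le i_j\le r-1$. Define $T^{\vec i}_{\vec\ell}=R^{(i_1)}_{1,\ell_1}R^{(i_2)}_{\ell_1+1,\ell_2}\cdots R^{(i_m)}_{\ell_{m-1}+1,\ell_m}\in H_{r,n}$. For a standard tableau $L$ of any shape (possibly skew) with $N\geq 1$ boxes, $\Delta^{(i)}(L)=\mathrm{ct}(L(1))^i\,(T_2)_{LL}(T_3)_{LL}\cdots(T_N)_{LL}$,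 and for any shape $\lambda$, $\Delta^{(i)}(\lambda)=\sum_{L\in\mathcal{L}(\lambda)}\Delta^{(i)}(L)$. *)

(* Defs.v *)
From HB Require Import structures.
From mathcomp Require Import all_boot all_order all_algebra fingroup perm.
From mathcomp Require Import fraction generic_quotient boolp reals complex.
From mathcomp Require Import ring zify finmap.
From mathcomp Require mpoly monalg.

Set Implicit Arguments.
Unset Strict Implicit.
Unset Printing Implicit Defensive.

Import GRing.Theory.
Local Open Scope ring_scope.

Section RationalFunctions.

Import mpoly.

(* The field C(u_1, ..., u_r, q): the last polynomial variable is q. *)
Definition ratfun (C : fieldType) (r : nat) : fieldType :=
  {fraction {mpoly C[r.+1]}}.

Definition qvar (C : fieldType) (r : nat) : ratfun C r :=
  tofrac ('X_ord_max : {mpoly C[r.+1]}).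

Definition uvar (C : fieldType) (r : nat) (k : 'I_r) : ratfun C r :=
  tofrac ('X_(widen_ord (leqnSn r) k) : {mpoly C[r.+1]}).

Lemma qvar_neq0 (C : fieldType) (r : nat) : qvar C r != 0.
Proof.
rewrite tofrac_eq0; apply/eqP => /mpolyP /(_ U_(ord_max)%MM) /eqP.
by rewrite mcoeffX eqxx mcoeff0 oner_eq0.
Qed.

Lemma uvar_neq0 (C : fieldType) (r : nat) (k : 'I_r) : uvar C k != 0.
Proof.
rewrite tofrac_eq0.
apply/eqP => /mpolyP /(_ U_(widen_ord (leqnSn r) k)%MM) /eqP.
by rewrite mcoeffX eqxx mcoeff0 oner_eq0.
Qed.

Lemma uvar_qvar_sep (C : fieldType) (r a a' : nat) (k k' : 'I_r) :
  uvar C k * qvar C r ^+ a = uvar C k' * qvar C r ^+ a' -> k = k' /\ a = a'.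
Proof.
rewrite /uvar /qvar -!tofracXn -!tofracM => /eqP; rewrite tofrac_eq => /eqP.
rewrite !mpolyXn -!mpolyXD => /mpolyP e.
have {}e : (U_(widen_ord (leqnSn r) k) + U_(ord_max) *+ a)%MM =
   (U_(widen_ord (leqnSn r) k') + U_(ord_max) *+ a')%MM.
  move: (e (U_(widen_ord (leqnSn r) k) + U_(ord_max) *+ a)%MM).
  rewrite !mcoeffX eqxx; case: eqP => [-> //|_] /eqP; by rewrite oner_eq0.
have wm (l : 'I_r) : (widen_ord (leqnSn r) l == ord_max) = false.
  by apply/negbTE; rewrite -val_eqE /= neq_ltn ltn_ord.
have wi (l l' : 'I_r) :
    (widen_ord (leqnSn r) l == widen_ord (leqnSn r) l') = (l == l').
  by rewrite -!val_eqE.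
split.
- move/mnmP/(_ (widen_ord (leqnSn r) k)): e.
  rewrite !mnmDE !mulmnE !mnm1E ![ord_max == _]eq_sym !wm !wi eqxx !mul0n !addn0.
  by case: eqP => [->|].
- move/mnmP/(_ ord_max): e.
  by rewrite !mnmDE !mulmnE !mnm1E !wm eqxx !mul1n.
Qed.

End RationalFunctions.
Import monalg.

Local Open Scope quotient_scope.

Inductive two_sided_ideal (A : pzRingType) (S : A -> Prop) : A -> Prop :=
| TSI_gen x of S x : two_sided_ideal S x
| TSI_0 : two_sided_ideal S 0
| TSI_add x y of two_sided_ideal S x & two_sided_ideal S y :
    two_sided_ideal S (x + y)
| TSI_mul a x b of two_sided_ideal S x : two_sided_ideal S (a * x * b).

(* The Ariki-Koike algebra is the free algebra on T_1, ..., T_n modulo the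
   two-sided ideal generated by the differences of the two sides of its
   defining relations. *)
Section Algebra.

Variables (K : fieldType) (r : nat) (q : K) (u : 'I_r -> K) (n : nat).

Definition freealg : lalgType K := {malg K[{fmonom 'I_n}]}.

Local Notation free := freealg.

(* Free generators X_1, ..., X_n; labels outside 1, ..., n are never used. *)
Definition freegen (i : nat) : free :=
  oapp (fun k : 'I_n => << fmu k >> : {malg K[{fmonom 'I_n}]}) 0 (insub i.-1).

Local Notation X := freegen.

Inductive AK_relator : free -> Prop :=
| AK_comm i j of (1 <= i <= n)%N & (1 <= j <= n)%N & (i.+1 < j)%N :
    AK_relator (X i * X j - X j * X i)
| AK_braid i of (2 <= i <= n.-1)%N :
    AK_relator (X i * X i.+1 * X i - X i.+1 * X i * X i.+1)
| AK_braid4 of (2 <= n)%N :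
    AK_relator (X 1 * X 2 * X 1 * X 2 - X 2 * X 1 * X 2 * X 1)
| AK_cyclotomic of (1 <= n)%N :
    AK_relator (\prod_(k < r) (X 1 - (u k)%:A))
| AK_quad i of (2 <= i <= n)%N :
    AK_relator ((X i - q%:A) * (X i + (q^-1)%:A)).

Definition AK_ideal : free -> Prop := two_sided_ideal AK_relator.

Lemma AK_idealN x : AK_ideal x -> AK_ideal (- x).
Proof. by move=> hx; rewrite -[x]mulr1 -mulN1r mulrA; exact: TSI_mul. Qed.

Lemma AK_idealMl a x : AK_ideal x -> AK_ideal (a * x).
Proof. by move=> hx; rewrite -[a * x]mulr1; exact: TSI_mul. Qed.

Lemma AK_idealMr x b : AK_ideal x -> AK_ideal (x * b).
Proof. by move=> hx; rewrite -[x]mul1r; exact: TSI_mul. Qed.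

Definition AK_rel : rel free := fun x y => `[< AK_ideal (x - y) >].

Lemma AK_rel_refl : reflexive AK_rel.
Proof. by move=> x; apply/asboolP; rewrite subrr; exact: TSI_0. Qed.

Lemma AK_rel_sym : symmetric AK_rel.
Proof.
by move=> x y; apply/asboolP/asboolP => /AK_idealN; rewrite opprB.
Qed.

Lemma AK_rel_trans : transitive AK_rel.
Proof.
move=> y x z /asboolP h1 /asboolP h2; apply/asboolP.
by rewrite -(subrKA y); exact: TSI_add.
Qed.

Canonical AK_equiv := EquivRel AK_rel AK_rel_refl AK_rel_sym AK_rel_trans.

Definition AKalg : Type := {eq_quot AK_equiv}.

HB.instance Definition _ := Choice.on AKalg.
HB.instance Definition _ := EqQuotient.on AKalg.

Lemma AK_piP (x y : free) :
  AK_ideal (x - y) <-> \pi_AKalg x = \pi_AKalg y.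
Proof.
split=> [h|/eqmodP /asboolP //]; apply/eqmodP; exact/asboolP.
Qed.

Lemma AK_reprP (x : free) : AK_ideal (repr (\pi_AKalg x) - x).
Proof. by apply/AK_piP; rewrite reprK. Qed.

Definition AK_zero : AKalg := \pi_AKalg 0.
Definition AK_one : AKalg := \pi_AKalg 1.
Definition AK_opp (x : AKalg) : AKalg := \pi_AKalg (- repr x).
Definition AK_add (x y : AKalg) : AKalg := \pi_AKalg (repr x + repr y).
Definition AK_mul (x y : AKalg) : AKalg := \pi_AKalg (repr x * repr y).
Definition AK_scale (a : K) (x : AKalg) : AKalg := \pi_AKalg (a *: repr x).

Lemma pi_AK_opp x : AK_opp (\pi_AKalg x) = \pi_AKalg (- x).
Proof. by apply/AK_piP; rewrite -opprD; apply/AK_idealN/AK_reprP. Qed.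

Lemma pi_AK_add x y : AK_add (\pi_AKalg x) (\pi_AKalg y) = \pi_AKalg (x + y).
Proof.
by apply/AK_piP; rewrite opprD addrACA; apply: TSI_add; exact: AK_reprP.
Qed.

Lemma pi_AK_mul x y : AK_mul (\pi_AKalg x) (\pi_AKalg y) = \pi_AKalg (x * y).
Proof.
apply/AK_piP; set a := repr _; set b := repr _.
have -> : a * b - x * y = (a - x) * b + x * (b - y).
  by rewrite mulrBl mulrBr addrA subrK.
by apply: TSI_add; [apply: AK_idealMr|apply: AK_idealMl]; exact: AK_reprP.
Qed.

Lemma pi_AK_scale a x : AK_scale a (\pi_AKalg x) = \pi_AKalg (a *: x).
Proof.
apply/AK_piP; rewrite -scalerBr -[_ - x]mul1r scalerAl.
exact/AK_idealMl/AK_reprP.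
Qed.

Definition pi_AK := (pi_AK_opp, pi_AK_add, pi_AK_mul, pi_AK_scale).

Lemma AK_ind (P : AKalg -> Prop) :
  (forall x, P (\pi_AKalg x)) -> forall x, P x.
Proof. by move=> h x; rewrite -[x]reprK. Qed.

Fact AK_addA : associative AK_add.
Proof. by elim/AK_ind=> x; elim/AK_ind=> y; elim/AK_ind=> z; rewrite !pi_AK addrA. Qed.
Fact AK_addC : commutative AK_add.
Proof. by elim/AK_ind=> x; elim/AK_ind=> y; rewrite !pi_AK addrC. Qed.
Fact AK_add0 : left_id AK_zero AK_add.
Proof. by elim/AK_ind=> x; rewrite !pi_AK add0r. Qed.
Fact AK_addN : left_inverse AK_zero AK_opp AK_add.
Proof. by elim/AK_ind=> x; rewrite !pi_AK addNr. Qed.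

HB.instance Definition _ :=
  GRing.isZmodule.Build AKalg AK_addA AK_addC AK_add0 AK_addN.

Lemma AKpiD x y : \pi_AKalg x + \pi_AKalg y = \pi_AKalg (x + y).
Proof. exact: pi_AK_add. Qed.
Lemma AKpiN x : - \pi_AKalg x = \pi_AKalg (- x).
Proof. exact: pi_AK_opp. Qed.

Fact AK_mulA : associative AK_mul.
Proof. by elim/AK_ind=> x; elim/AK_ind=> y; elim/AK_ind=> z; rewrite !pi_AK mulrA. Qed.
Fact AK_mul1 : left_id AK_one AK_mul.
Proof. by elim/AK_ind=> x; rewrite !pi_AK mul1r. Qed.
Fact AK_mulr1 : right_id AK_one AK_mul.
Proof. by elim/AK_ind=> x; rewrite !pi_AK mulr1. Qed.
Fact AK_mulDl : left_distributive AK_mul AK_add.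
Proof. by elim/AK_ind=> x; elim/AK_ind=> y; elim/AK_ind=> z; rewrite !pi_AK mulrDl. Qed.
Fact AK_mulDr : right_distributive AK_mul AK_add.
Proof. by elim/AK_ind=> x; elim/AK_ind=> y; elim/AK_ind=> z; rewrite !pi_AK mulrDr. Qed.

HB.instance Definition _ := GRing.Zmodule_isPzRing.Build AKalg
  AK_mulA AK_mul1 AK_mulr1 AK_mulDl AK_mulDr.

Fact AK_scaleA a b x : AK_scale a (AK_scale b x) = AK_scale (a * b) x.
Proof. by elim/AK_ind: x => x; rewrite !pi_AK scalerA. Qed.
Fact AK_scale1 : left_id 1 AK_scale.
Proof. by elim/AK_ind=> x; rewrite !pi_AK scale1r. Qed.
Fact AK_scaleDr : right_distributive AK_scale +%R.
Proof.
move=> a; elim/AK_ind=> x; elim/AK_ind=> y.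
by rewrite AKpiD !pi_AK_scale AKpiD scalerDr.
Qed.
Fact AK_scaleDl x a b : AK_scale (a + b) x = AK_scale a x + AK_scale b x.
Proof.
by elim/AK_ind: x => x; rewrite !pi_AK_scale scalerDl AKpiD.
Qed.

HB.instance Definition _ := GRing.Zmodule_isLmodule.Build K AKalg
  AK_scaleA AK_scale1 AK_scaleDr AK_scaleDl.

Lemma AKpiM x y : \pi_AKalg x * \pi_AKalg y = \pi_AKalg (x * y).
Proof. exact: pi_AK_mul. Qed.
Lemma AKpiZ a x : a *: \pi_AKalg x = \pi_AKalg (a *: x).
Proof. exact: pi_AK_scale. Qed.

Lemma AK_scalerAl a (x y : AKalg) : a *: (x * y) = a *: x * y.
Proof.
elim/AK_ind: x => x; elim/AK_ind: y => y.
by rewrite AKpiM !AKpiZ AKpiM scalerAl.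
Qed.

Fact malg_scalerAr a (x y : {malg K[{fmonom 'I_n}]}) :
  a *: (x * y) = x * (a *: y).
Proof.
rewrite -[y in RHS]mul1r [in RHS]scalerAl [in RHS]mulrA [LHS]scalerAl.
congr (_ * _).
rewrite -[a *: 1]mul_malgC mulr1 malgM_def fgmulgU malgZ_def.
by apply: eq_bigr => w _; rewrite mulm1 mulrC.
Qed.

Fact free_scalerAr a (x y : free) : a *: (x * y) = x * (a *: y).
Proof. exact: malg_scalerAr. Qed.

Lemma AK_scalerAr a (x y : AKalg) : a *: (x * y) = x * (a *: y).
Proof.
elim/AK_ind: x => x; elim/AK_ind: y => y.
by rewrite AKpiM !AKpiZ AKpiM free_scalerAr.
Qed.

Definition AKgen (i : nat) : AKalg := \pi_AKalg (freegen i).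

(* Evaluation of a noncommutative polynomial at square matrices M_1, ..., M_n,
   and the representation of the algebra it induces. *)
Section Evaluation.

Variables (d : nat) (M : 'I_n -> 'M[K]_d).

Definition mxword (w : {fmonom 'I_n}) : 'M[K]_d :=
  \prod_(k <- (w : seq 'I_n)) M k.

Definition mxeval (f : free) : 'M[K]_d :=
  \sum_(w <- msupp (f : {malg K[{fmonom 'I_n}]}))
    (f : {malg K[{fmonom 'I_n}]})@_w *: mxword w.

Section MalgEvaluation.

Local Notation malgT := {malg K[{fmonom 'I_n}]}.

Lemma malg_evalEw (D : {fset {fmonom 'I_n}}) (f : malgT) :
  (msupp f `<=` D)%fset -> mxeval f = \sum_(w <- D) f@_w *: mxword w.
Proof.
move=> le; rewrite [LHS](big_fset_incl _ le) => //= w _ /mcoeff_outdom ->.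
by rewrite scale0r.
Qed.

Lemma malg_evalU c w : mxeval (<< c *g w >> : malgT) = c *: mxword w.
Proof. by rewrite (malg_evalEw msuppU_le) big_seq_fset1 mcoeffUU. Qed.

Lemma malg_eval0 : mxeval (0 : malgT) = 0.
Proof. by rewrite /mxeval msupp0 big_seq_fset0. Qed.

Lemma malg_evalD (f g : malgT) : mxeval (f + g) = mxeval f + mxeval g.
Proof.
rewrite (malg_evalEw (msuppD_le _ _)).
rewrite (malg_evalEw (fsubsetUl (msupp f) (msupp g))).
rewrite (malg_evalEw (fsubsetUr (msupp f) (msupp g))) -big_split /=.
by apply: eq_bigr => w _; rewrite mcoeffD scalerDl.
Qed.

Lemma malg_evalZ a (f : malgT) : mxeval (a *: f) = a *: mxeval f.
Proof.
rewrite (malg_evalEw (msuppZ_le _ _)) scaler_sumr.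
by apply: eq_bigr => w _; rewrite mcoeffZ scalerA.
Qed.

Lemma malg_eval_sum (I : Type) (s : seq I) (F : I -> malgT) :
  mxeval (\sum_(i <- s) F i) = \sum_(i <- s) mxeval (F i).
Proof. by apply: (big_morph _ malg_evalD malg_eval0). Qed.

Lemma malg_eval1 : mxeval (1 : malgT) = 1.
Proof. by rewrite malg_evalU scale1r /mxword fm1 big_nil. Qed.

Lemma malg_evalM (f g : malgT) : mxeval (f * g) = mxeval f * mxeval g.
Proof.
rewrite malgME malg_eval_sum mulr_suml; apply: eq_bigr => v _.
rewrite malg_eval_sum mulr_sumr; apply: eq_bigr => w _.
rewrite malg_evalU /mxword fmM big_cat /= -[LHS]scalerA.
by rewrite -!mulmxE -scalemxAl -scalemxAr.
Qed.

End MalgEvaluation.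

Lemma mxeval0 : mxeval 0 = 0. Proof. exact: malg_eval0. Qed.
Lemma mxeval1 : mxeval 1 = 1. Proof. exact: malg_eval1. Qed.
Lemma mxevalD (f g : free) : mxeval (f + g) = mxeval f + mxeval g.
Proof. exact: malg_evalD. Qed.
Lemma mxevalM (f g : free) : mxeval (f * g) = mxeval f * mxeval g.
Proof. exact: malg_evalM. Qed.
Lemma mxevalZ a (f : free) : mxeval (a *: f) = a *: mxeval f.
Proof. exact: malg_evalZ. Qed.
Lemma mxevalN (f : free) : mxeval (- f) = - mxeval f.
Proof. by rewrite -scaleN1r mxevalZ scaleN1r. Qed.
Lemma mxevalB (f g : free) : mxeval (f - g) = mxeval f - mxeval g.
Proof. by rewrite mxevalD mxevalN. Qed.

Lemma mxeval_gen (k : 'I_n) : mxeval (freegen k.+1) = M k.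
Proof.
by rewrite /freegen /= valK /= malg_evalU scale1r /mxword fmU big_seq1.
Qed.

Definition AK_relations_hold := forall x, AK_relator x -> mxeval x = 0.

Lemma mxevalA a : mxeval a%:A = a%:M.
Proof. by rewrite mxevalZ mxeval1 scalemx1. Qed.

Lemma AK_relations_intro :
  (forall k l : 'I_n, (k.+1 < l)%N -> M k * M l = M l * M k) ->
  (forall k l : 'I_n, (0 < k)%N -> l = k.+1 :> nat ->
     M k * M l * M k = M l * M k * M l) ->
  (forall k l : 'I_n, k = 0%N :> nat -> l = 1%N :> nat ->
     M k * M l * M k * M l = M l * M k * M l * M k) ->
  (forall k : 'I_n, k = 0%N :> nat -> \prod_(j < r) (M k - (u j)%:M) = 0) ->
  (forall k : 'I_n, (0 < k)%N -> (M k - q%:M) * (M k + q^-1%:M) = 0) ->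
  AK_relations_hold.
Proof.
have lab i : (1 <= i <= n)%N -> exists2 k : 'I_n, i = k.+1 & mxeval (X i) = M k.
  case: i => // i /= lti; exists (Ordinal lti) => //.
  exact: (mxeval_gen (Ordinal lti)).
have evB (x y : free) A B : mxeval x = A -> mxeval y = B -> A = B ->
    mxeval (x - y) = 0.
  by move=> ex ey eAB; rewrite mxevalB ex ey eAB subrr.
have evM (x y : free) A B : mxeval x = A -> mxeval y = B ->
    mxeval (x * y) = A * B.
  by move=> ex ey; rewrite mxevalM ex ey.
move=> Hc Hb H4 Hy Hq x [i j|i|||i].
- move=> /lab[k -> e1] /lab[l -> e2] ltkl.
  exact: (evB _ _ _ _ (evM _ _ _ _ e1 e2) (evM _ _ _ _ e2 e1) (Hc _ _ ltkl)).
- move=> /andP[i2 iN].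
  have n0 : (0 < n)%N by case: n iN i2 => //; case: i.
  have ltin : (i < n)%N by rewrite -(prednK n0) ltnS.
  have /lab[k ik eX] : (1 <= i <= n)%N by rewrite (ltnW i2) ltnW.
  have /lab[l [il] eY] : (1 <= i.+1 <= n)%N by [].
  have k0 : (0 < k)%N by rewrite -ltnS -ik.
  have lk : l = k.+1 :> nat by rewrite -il.
  apply: (evB _ _ _ _ _ _ (Hb k l k0 lk)).
    exact: evM (evM _ _ _ _ eX eY) eX.
  exact: evM (evM _ _ _ _ eY eX) eY.
- move=> n2.
  have /lab[k [k0] eX] : (1 <= 1 <= n)%N by exact: ltnW.
  have /lab[l [l1] eY] : (1 <= 2 <= n)%N by [].
  apply: (evB _ _ _ _ _ _ (H4 k l (esym k0) (esym l1))).
    exact: evM (evM _ _ _ _ (evM _ _ _ _ eX eY) eX) eY.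
  exact: evM (evM _ _ _ _ (evM _ _ _ _ eY eX) eY) eX.
- move=> n1.
  have /lab[k [k0] eX] : (1 <= 1 <= n)%N by [].
  rewrite (big_morph mxeval mxevalM mxeval1) -[RHS](Hy k (esym k0)).
  by apply: eq_bigr => j _; rewrite mxevalB mxevalA eX.
- move=> /andP[i2 iN].
  have /lab[k ik eX] : (1 <= i <= n)%N by rewrite (ltnW i2).
  have k0 : (0 < k)%N by rewrite -ltnS -ik.
  have e1 : mxeval (X i - q%:A) = M k - q%:M by rewrite mxevalB mxevalA eX.
  have e2 : mxeval (X i + q^-1%:A) = M k + q^-1%:M by rewrite mxevalD mxevalA eX.
  exact: etrans (evM _ _ _ _ e1 e2) (Hq k k0).
Qed.

Hypothesis relM : AK_relations_hold.

Lemma mxeval_ideal x : AK_ideal x -> mxeval x = 0.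
Proof.
elim=> {x} [x /relM //||x y _ hx _ hy|a x b _ hx].
- exact: mxeval0.
- by rewrite mxevalD hx hy addr0.
- by rewrite !mxevalM hx mulr0 mul0r.
Qed.

Definition AK_lift of AK_relations_hold := fun x : AKalg => mxeval (repr x).

Lemma AK_lift_pi x : AK_lift relM (\pi_AKalg x) = mxeval x.
Proof.
by apply/eqP; rewrite -subr_eq0 -mxevalB; apply/eqP/mxeval_ideal/AK_reprP.
Qed.

Lemma AK_lift_gen (k : 'I_n) : AK_lift relM (AKgen k.+1) = M k.
Proof. by rewrite AK_lift_pi mxeval_gen. Qed.

Fact AK_lift_zmod_morphism : zmod_morphism (AK_lift relM).
Proof.
elim/AK_ind=> x; elim/AK_ind=> y.
have -> : \pi_AKalg x - \pi_AKalg y = \pi_AKalg (x - y).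
  by rewrite AKpiN AKpiD.
by rewrite !AK_lift_pi mxevalB.
Qed.

Fact AK_lift_monoid_morphism : monoid_morphism (AK_lift relM).
Proof.
split=> [|]; first by rewrite AK_lift_pi mxeval1.
elim/AK_ind=> x; elim/AK_ind=> y.
have -> : \pi_AKalg x * \pi_AKalg y = \pi_AKalg (x * y).
  exact: AKpiM.
by rewrite !AK_lift_pi mxevalM.
Qed.

Fact AK_lift_scalable : scalable (AK_lift relM).
Proof.
move=> a; elim/AK_ind=> x.
have -> : a *: \pi_AKalg x = \pi_AKalg (a *: x).
  exact: AKpiZ.
by rewrite !AK_lift_pi mxevalZ.
Qed.

HB.instance Definition _ := GRing.isZmodMorphism.Build AKalg 'M[K]_d
  (AK_lift relM) AK_lift_zmod_morphism.
HB.instance Definition _ := GRing.isMonoidMorphism.Build AKalg 'M[K]_d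
  (AK_lift relM) AK_lift_monoid_morphism.
HB.instance Definition _ := GRing.isScalable.Build K AKalg 'M[K]_d *:%R
  (AK_lift relM) AK_lift_scalable.

End Evaluation.

End Algebra.

(* For r > 0 the algebra is nonzero: T_1 |-> u_1, T_i |-> q is a
   one-dimensional representation. *)
Section AlgebraNontrivial.

Variables (K : fieldType) (r : nat) (q : K) (u : 'I_r.+1 -> K) (n : nat).

Let M (k : 'I_n) : 'M[K]_1 := (if k == 0%N :> nat then u ord0 else q)%:M.

Let relM : AK_relations_hold q u M.
Proof.
apply: AK_relations_intro => [k l _|k l k0 lk|k l k0 l1|k k0|k k0].
- by rewrite /M -!mulmxE scalar_mxC.
- by rewrite /M lk (gtn_eqF k0) /=.
- by rewrite /M k0 l1 /= -!mulmxE -!scalar_mxM; congr _%:M; ring.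
- by rewrite /M k0 eqxx big_ord_recl subrr mul0r.
- by rewrite /M (gtn_eqF k0) subrr mul0r.
Qed.

Fact AK_one_neq0 : (1 : AKalg q u n) != 0.
Proof.
apply/eqP => /(congr1 (AK_lift relM)); rewrite rmorph1 raddf0.
by move/matrixP/(_ ord0 ord0)/eqP; rewrite !mxE oner_eq0.
Qed.

HB.instance Definition _ :=
  GRing.PzSemiRing_isNonZero.Build (AKalg q u n) AK_one_neq0.
HB.instance Definition _ :=
  GRing.Lmodule_isLalgebra.Build K (AKalg q u n) (@AK_scalerAl K r.+1 q u n).
HB.instance Definition _ :=
  GRing.Lalgebra_isAlgebra.Build K (AKalg q u n) (@AK_scalerAr K r.+1 q u n).

End AlgebraNontrivial.

(* Boxes of r-partitions of size at most n: all rows and columns are < n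
   (rows, columns and components are numbered from 0). *)
Definition box (r n : nat) : finType := ('I_r * ('I_n * 'I_n))%type.

Definition comp r n (b : box r n) : 'I_r := b.1.
Definition row_of r n (b : box r n) : 'I_n := b.2.1.
Definition col_of r n (b : box r n) : 'I_n := b.2.2.

(* A partition of size at most n has at most n parts, all at most n; it is
   given by its parts in weakly decreasing order, padded with zeros. *)
Definition part (n : nat) : finType :=
  {p : n.-tuple 'I_n.+1 | sorted geq [seq nat_of_ord x | x <- p]}.

Definition rpart (r n : nat) : finType := {ffun 'I_r -> part n}.

Definition diagram r n (mu : rpart r n) : {set box r n} :=
  [set b | (col_of b < tnth (val (mu (comp b))) (row_of b))%N].

Lemma diagram_down r n (mu : rpart r n) (b b' : box r n) :
  b' \in diagram mu -> comp b = comp b' -> (row_of b <= row_of b')%N ->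
  (col_of b <= col_of b')%N -> b \in diagram mu.
Proof.
rewrite !inE => hb' -> hr hc; apply: leq_ltn_trans hc (leq_trans hb' _).
case: (mu (comp b')) => p /= sp.
have srt : sorted geq [seq nat_of_ord x | x <- p] by [].
have := @sorted_leq_nth _ geq (fun y x z h1 h2 => leq_trans h2 h1) leqnn 0%N
  _ srt (row_of b) (row_of b').
rewrite !inE !size_map size_tuple !ltn_ord => /(_ isT isT hr).
have x0 : 'I_n.+1 by exact: ord0.
by rewrite !(nth_map x0) ?size_tuple ?ltn_ord // -!tnth_nth.
Qed.

(* b is to the left of b' in the same row, or above b' in the same column *)
Definition box_before r n (b b' : box r n) : bool :=
  (comp b == comp b') &&
  ((row_of b == row_of b') && (col_of b < col_of b')%N
   || (col_of b == col_of b') && (row_of b < row_of b')%N).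

Lemma before_row r n (x y : box r n) : comp x = comp y ->
  row_of x = row_of y -> (col_of x < col_of y)%N -> box_before x y.
Proof. by move=> e1 e2 h; rewrite /box_before e1 e2 !eqxx h. Qed.

Lemma before_col r n (x y : box r n) : comp x = comp y ->
  col_of x = col_of y -> (row_of x < row_of y)%N -> box_before x y.
Proof. by move=> e1 e2 h; rewrite /box_before e1 e2 !eqxx h orbT. Qed.

(* A filling is encoded by the sequence (L(1), ..., L(N)) of its boxes, so
   that the entry of b is (index b L).+1. *)
Definition is_standard r n (S : {set box r n}) (L : seq (box r n)) : bool :=
  [&& uniq L, [forall b, (b \in L) == (b \in S)] &
   [forall b in S, forall b' in S,
      box_before b b' ==> (index b L < index b' L)%N]].

Definition stdtab r n (N : nat) (S : {set box r n}) : finType :=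
  {L : N.-tuple (box r n) | is_standard S L}.

(* s_i L for the label i = k.+1; only used for k > 0, where ord_pred k is the
   predecessor k.-1. *)
Definition swap_tab r n (N : nat) (k : 'I_N) (L : N.-tuple (box r n)) :
    N.-tuple (box r n) :=
  [tuple tnth L (tperm (ord_pred k) k j) | j < N].

Section SeminormalForm.

Variables (K : fieldType) (r n : nat) (q : K) (u : 'I_r -> K).

Local Notation box := (box r n).

Definition ct (b : box) : K :=
  u (comp b) * q ^ (2%:Z * ((col_of b)%:Z - (row_of b)%:Z)).

(* (T_i)_{LL} for i = k.+1 >= 2 *)
Definition Tdiag (N : nat) (k : 'I_N) (L : N.-tuple box) : K :=
  (q - q^-1) / (1 - ct (tnth L (ord_pred k)) / ct (tnth L k)).

(* The contents of L(1), ..., L(N) are the entries of map ct L. *)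
Definition Delta_tab (e N : nat) (L : N.-tuple box) : K :=
  head 0 (map ct L) ^+ e * \prod_(k < N | (0 < k)%N) Tdiag k L.

Definition Delta (e : nat) (S : {set box}) : K :=
  \sum_(L : stdtab #|S| S) Delta_tab e (val L).

(* Matrix of T_{k+1} in the basis (v_L): the column of L is T_{k+1} v_L. *)
Definition seminormal (S : {set box}) (k : 'I_n) :
    'M[K]_#|stdtab n S| :=
  \matrix_(a, b)
    let L' : n.-tuple box := val (enum_val a) in
    let L : n.-tuple box := val (enum_val b) in
    if (k == 0 :> nat)%N then (L' == L)%:R * ct (tnth L k)
    else (L' == L)%:R * Tdiag k L
         + (L' == swap_tab k L)%:R * (q^-1 + Tdiag k L).

Section Relations.

Variable lam : rpart r n.

Hypotheses (q0 : q != 0) (u0 : forall k, u k != 0).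
Hypothesis sep : forall (k k' : 'I_r) (a a' : nat),
  u k * q ^+ a = u k' * q ^+ a' -> k = k' /\ a = a'.

Local Notation S := (diagram lam).
Local Notation std L := (is_standard S (tval L)).
Local Notation d := #|stdtab n S|.
Local Notation tab := (n.-tuple box).
Local Notation M := (seminormal S).

Lemma ct_neq0 b : ct b != 0.
Proof. by rewrite mulf_neq0 // expfz_neq0. Qed.

Lemma ct_inj_diag b b' : ct b = ct b' ->
  comp b = comp b' /\ (col_of b + row_of b' = col_of b' + row_of b)%N.
Proof.
rewrite /ct => e.
have : u (comp b) * q ^+ (2 * (col_of b + row_of b'))%N =
       u (comp b') * q ^+ (2 * (col_of b' + row_of b))%N.
  have ex (i j i' : nat) : q ^+ (2 * (j + i'))%N =
      q ^ (2%:Z * (j%:Z - i%:Z)) * (q ^ (2 * (i + i')%N%:Z)).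
    by rewrite -expfzDr // exprnP; congr (q ^ _); lia.
  rewrite (ex (row_of b)) (ex (row_of b')) [X in 2 * X%:Z]addnC !mulrA e.
  by rewrite [X in 2 * X%:Z]addnC.
by case/sep => -> h; split=> //; lia.
Qed.

Definition acoef (x y : box) : K := (q - q^-1) / (1 - ct x / ct y).
Definition bcoef (x y : box) : K := q^-1 + acoef x y.

Lemma acoefE x y : ct x != ct y ->
  acoef x y = (q - q^-1) * ct y / (ct y - ct x).
Proof.
move=> h; have h2 : ct y - ct x != 0 by rewrite subr_eq0 eq_sym.
by rewrite /acoef; field; rewrite h2 ct_neq0 q0.
Qed.

Definition e_ (L : tab) : 'cV[K]_d := \col_a (val (enum_val a) == L)%:R.

Lemma stdE (L : tab) : std L ->
  [/\ uniq L, forall b, (b \in tval L) = (b \in S) &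
   forall i j : 'I_n, box_before (tnth L i) (tnth L j) -> (i < j)%N].
Proof.
case/and3P => U /forallP m /forall_inP h; split=> //.
  by move=> b; apply/eqP.
move=> i j pre.
have mS k : tnth L k \in S by rewrite -(eqP (m _)) mem_tnth.
move/forall_inP: (h _ (mS i)) => /(_ _ (mS j)) /implyP /(_ pre).
have x0 := tnth L i.
by rewrite !(tnth_nth x0) !index_uniq ?size_tuple.
Qed.

Lemma stdI (L : tab) : uniq L -> (forall b, (b \in tval L) = (b \in S)) ->
  (forall i j : 'I_n, box_before (tnth L i) (tnth L j) -> (i < j)%N) -> std L.
Proof.
move=> U m h; apply/and3P; split=> //.
  by apply/forallP => b; rewrite m.
apply/forall_inP => b; rewrite -m => /tnthP[i ->].
apply/forall_inP => b'; rewrite -m => /tnthP[j ->].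
apply/implyP => /h; have x0 := tnth L i.
by rewrite !(tnth_nth x0) !index_uniq ?size_tuple.
Qed.

Lemma e0 (L : tab) (i j : 'I_n) :
  (i < j)%N -> box_before (tnth L j) (tnth L i) -> e_ L = 0.
Proof.
move=> ltij pre; apply/colP => a; rewrite !mxE; case: eqP => // eL.
have sL : std L by rewrite -eL (valP (enum_val a)).
by case/stdE: sL => _ _ /(_ _ _ pre); rewrite ltnNge ltnW.
Qed.

Lemma mx_eq_e (A B : 'M[K]_d) :
  (forall L : tab, std L -> A *m e_ L = B *m e_ L) -> A = B.
Proof.
move=> h.
have ce (C : 'M[K]_d) a : C *m e_ (val (enum_val a)) = col a C.
  apply/colP => b; rewrite !mxE (bigD1 a) //= big1 ?addr0.
    by rewrite !mxE eqxx mulr1.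
  by move=> c /negbTE ca; rewrite mxE val_eqE (inj_eq enum_val_inj) ca mulr0.
apply/matrixP => i j; have := h _ (valP (enum_val j)); rewrite !ce => /colP.
by move=> /(_ i); rewrite !mxE.
Qed.

Lemma M_e (L : tab) (k : 'I_n) : std L ->
  M k *m e_ L = if (k == 0 :> nat)%N then ct (tnth L k) *: e_ L
    else Tdiag k L *: e_ L + (q^-1 + Tdiag k L) *: e_ (swap_tab k L).
Proof.
move=> sL; pose t : stdtab n S := exist _ L sL.
apply/colP => a; rewrite !mxE (bigD1 (enum_rank t)) //= big1 ?addr0.
  rewrite !mxE enum_rankK eqxx mulr1.
  by case: ifP => _; rewrite !mxE /=; [rewrite mulrC|congr (_ + _); rewrite mulrC].
move=> c ct_; rewrite [X in _ * X]mxE; case: eqP => [e|_]; last by rewrite mulr0.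
by case/eqP: ct_; apply: enum_val_inj; rewrite enum_rankK; apply: val_inj.
Qed.

Lemma ord_predE (k : 'I_n) : (0 < k)%N -> ord_pred k = k.-1 :> nat.
Proof.
move=> k0 /=; have kn := ltn_ord k.
have -> : ((k + n).-1 = k.-1 + n)%N by rewrite -(prednK k0) addSn.
by rewrite modnDr modn_small // (leq_ltn_trans _ kn) // leq_pred.
Qed.

Lemma tnth_swap (L : tab) (k j : 'I_n) :
  tnth (swap_tab k L) j = tnth L (tperm (ord_pred k) k j).
Proof. by rewrite tnth_mktuple. Qed.

Lemma tnth_swapL (L : tab) (k : 'I_n) :
  tnth (swap_tab k L) (ord_pred k) = tnth L k.
Proof. by rewrite tnth_swap tpermL. Qed.

Lemma tnth_swapR (L : tab) (k : 'I_n) :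
  tnth (swap_tab k L) k = tnth L (ord_pred k).
Proof. by rewrite tnth_swap tpermR. Qed.

Lemma tnth_swapD (L : tab) (k j : 'I_n) : ord_pred k != j -> k != j ->
  tnth (swap_tab k L) j = tnth L j.
Proof. by move=> h1 h2; rewrite tnth_swap tpermD. Qed.

Lemma swapK k : involutive (@swap_tab r n n k).
Proof. by move=> L; apply: eq_from_tnth => j; rewrite !tnth_swap tpermK. Qed.

Lemma swap_dich (L : tab) (k : 'I_n) : std L -> (0 < k)%N ->
  std (swap_tab k L) \/ box_before (tnth L (ord_pred k)) (tnth L k).
Proof.
move=> /stdE[U m h] k0.
case pre: (box_before _ _); [by right|left].
have pk := ord_predE k0.
apply: stdI.
- apply/tuple_uniqP => i j; rewrite !tnth_swap => /(tuple_uniqP _ U).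
  exact: perm_inj.
- move=> b; rewrite -m; apply/tnthP/tnthP => [[i ->]|[i ->]].
    by rewrite tnth_swap; eexists.
  by exists (tperm (ord_pred k) k i); rewrite tnth_swap tpermK.
- move=> i j; rewrite !tnth_swap => bij.
  move: (bij) (h _ _ bij) pk pre.
  move: (ord_pred k) => p {bij}.
  case: tpermP => [->|->|/eqP + /eqP +]; case: tpermP => [->|->|/eqP + /eqP +];
    rewrite -?val_eqE /= => *; try lia; by congruence.
Qed.

Lemma e_swap0 (L : tab) (k : 'I_n) : (0 < k)%N ->
  box_before (tnth L (ord_pred k)) (tnth L k) -> e_ (swap_tab k L) = 0.
Proof.
move=> k0 pre; apply: (@e0 _ (ord_pred k) k).
  by rewrite ord_predE // prednK.
by rewrite tnth_swapL tnth_swapR.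
Qed.

Lemma ct_adjacent (L : tab) (k : 'I_n) : std L -> (0 < k)%N ->
  let x := tnth L (ord_pred k) in let y := tnth L k in
  box_before x y -> ct y = q ^+ 2 * ct x \/ ct x = q ^+ 2 * ct y.
Proof.
move=> /stdE[U m h] k0 x y; have pk := ord_predE k0.
have yS : y \in S by rewrite -m mem_tnth.
have nobtw z : z \in S -> box_before x z -> box_before z y -> False.
  rewrite -m => /tnthP[i ->] /h h1 /h h2.
  by move: h1 h2; rewrite pk; lia.
case/andP => /eqP ec /orP[] /andP[/eqP er lt]; [left|right].
- have ey : (col_of y = (col_of x).+1 :> nat).
    apply/eqP; rewrite eqn_leq lt andbT leqNgt; apply/negP => lt2.
    have cz : ((col_of x).+1 < n)%N := leq_ltn_trans lt (ltn_ord _).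
    pose z : box := (comp x, (row_of x, Ordinal cz)).
    apply: (nobtw z).
    + apply: (@diagram_down _ _ _ z _ yS ec _ lt).
      exact: eq_leq (congr1 (@nat_of_ord n) er).
    + exact: (@before_row _ _ x z).
    + exact: (@before_row _ _ z y).
  rewrite /ct ec er ey mulrCA exprnP -expfzDr //; congr (_ * q ^ _); lia.
- have ey : (row_of y = (row_of x).+1 :> nat).
    apply/eqP; rewrite eqn_leq lt andbT leqNgt; apply/negP => lt2.
    have cz : ((row_of x).+1 < n)%N := leq_ltn_trans lt (ltn_ord _).
    pose z : box := (comp x, (Ordinal cz, col_of x)).
    apply: (nobtw z).
    + apply: (@diagram_down _ _ _ z _ yS ec lt).
      exact: eq_leq (congr1 (@nat_of_ord n) er).
    + exact: (@before_col _ _ x z).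
    + exact: (@before_col _ _ z y).
  rewrite /ct ec er ey mulrCA exprnP -expfzDr //; congr (_ * q ^ _); lia.
Qed.

Lemma ct_distinct (L : tab) (i j : 'I_n) : std L ->
  (i < j)%N -> (j <= i.+2)%N -> ct (tnth L i) != ct (tnth L j).
Proof.
move=> /stdE[U m h] ltij leji; apply/eqP => /ct_inj_diag[ec ed].
have inS k : tnth L k \in S by rewrite -m mem_tnth.
have gen (k l : 'I_n) : comp (tnth L k) = comp (tnth L l) ->
    (col_of (tnth L k) < col_of (tnth L l))%N ->
    (row_of (tnth L k) < row_of (tnth L l))%N -> (k.+2 < l)%N.
  move=> ekl ltc ltr; set x := tnth L k in ekl ltc ltr.
  set y := tnth L l in ekl ltc ltr.
  pose z1 : box := (comp x, (row_of x, col_of y)).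
  pose z2 : box := (comp x, (row_of y, col_of x)).
  have /tnthP[a ea] : z1 \in tval L.
    rewrite m.
    exact: (@diagram_down _ _ _ z1 _ (inS l) ekl (ltnW ltr) (leqnn _)).
  have /tnthP[b eb] : z2 \in tval L.
    rewrite m.
    exact: (@diagram_down _ _ _ z2 _ (inS l) ekl (leqnn _) (ltnW ltc)).
  have ka : (k < a)%N by apply: h; rewrite -ea; apply: before_row.
  have kb : (k < b)%N by apply: h; rewrite -eb; apply: before_col.
  have al : (a < l)%N by apply: h; rewrite -ea; apply: before_col.
  have bl : (b < l)%N by apply: h; rewrite -eb; apply: before_row.
  have ab : a != b :> nat.
    apply/eqP => /val_inj eab.
    have e : col_of y = col_of x := congr1 (@col_of r n)
      (etrans ea (etrans (congr1 (tnth L) eab) (esym eb))).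
    by rewrite e ltnn in ltc.
  lia.
have [ltc|ltc|ec2] := ltngtP (col_of (tnth L i)) (col_of (tnth L j)).
- have /(gen _ _ ec ltc) : (row_of (tnth L i) < row_of (tnth L j))%N by lia.
  lia.
- have /(gen _ _ (esym ec) ltc) : (row_of (tnth L j) < row_of (tnth L i))%N.
    lia.
  lia.
- have er2 : row_of (tnth L i) = row_of (tnth L j) :> nat by lia.
  have e : tnth L i = tnth L j.
    move: ec er2 ec2; rewrite /comp /row_of /col_of.
    by case: (tnth L i) (tnth L j) => [? [? ?]] [? [? ?]] /= -> /val_inj-> /val_inj->.
  by move/(tuple_uniqP _ U): e => e; rewrite e ltnn in ltij.
Qed.

Lemma acoefD x y : ct x != ct y -> acoef x y + acoef y x = q - q^-1.
Proof.
move=> h; have h1 : ct y - ct x != 0 by rewrite subr_eq0 eq_sym.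
have h2 : ct x - ct y != 0 by rewrite subr_eq0.
rewrite !acoefE //; last by rewrite eq_sym.
by field; rewrite q0 h1 h2.
Qed.

Lemma bcoef_adjacent (L : tab) (k : 'I_n) : std L -> (0 < k)%N ->
  let x := tnth L (ord_pred k) in let y := tnth L k in
  box_before x y -> bcoef x y * bcoef y x = 0.
Proof.
move=> sL k0 x y pre; have pk := ord_predE k0.
have cxy : ct x != ct y by apply: ct_distinct; rewrite // pk; lia.
have key a b : ct a != ct b -> ct b = q ^+ 2 * ct a -> bcoef b a = 0.
  move=> ab e; rewrite /bcoef acoefE 1?eq_sym // e.
  have ca := ct_neq0 a.
  have h : 1 - q ^+ 2 != 0.
    apply: contraNneq ab => /eqP; rewrite subr_eq0 => /eqP h.
    by rewrite e -h mul1r.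
  have h' : ct a - q ^+ 2 * ct a != 0 by rewrite -[X in X - _]mul1r -mulrBl mulf_neq0.
  by field; rewrite q0 h'.
case: (ct_adjacent sL k0 pre) => e.
  by rewrite (key x y cxy e) mulr0.
by rewrite (key y x _ e) ?mul0r // eq_sym.
Qed.

Lemma M_e_pos (L : tab) (k : 'I_n) : std L -> (0 < k)%N ->
  let x := tnth L (ord_pred k) in let y := tnth L k in
  M k *m e_ L = acoef x y *: e_ L + bcoef x y *: e_ (swap_tab k L).
Proof. by move=> sL k0; rewrite M_e // (gtn_eqF k0). Qed.

Lemma M_e_weak (L : tab) (k : 'I_n) : (0 < k)%N ->
  std L \/ (e_ L = 0 /\ e_ (swap_tab k L) = 0) ->
  M k *m e_ L = acoef (tnth L (ord_pred k)) (tnth L k) *: e_ L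
    + bcoef (tnth L (ord_pred k)) (tnth L k) *: e_ (swap_tab k L).
Proof.
move=> k0 [sL|[-> ->]]; first exact: M_e_pos.
by rewrite mulmx0 !scaler0 addr0.
Qed.

Lemma M_e_swap (L : tab) (k : 'I_n) : std L -> (0 < k)%N ->
  let x := tnth L (ord_pred k) in let y := tnth L k in
  bcoef x y *: (M k *m e_ (swap_tab k L)) =
  bcoef x y *: (acoef y x *: e_ (swap_tab k L) + bcoef y x *: e_ L).
Proof.
move=> sL k0 x y; case: (swap_dich sL k0) => [sL1|pre].
  by rewrite M_e_pos // swapK tnth_swapL tnth_swapR.
rewrite (e_swap0 k0 pre) mulmx0 !scaler0 add0r scalerA.
by rewrite bcoef_adjacent // scale0r.
Qed.

Lemma acoef_I1 x y z : ct x != ct y -> ct y != ct z -> ct x != ct z ->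
  acoef x y * acoef y z + acoef x z * acoef y x - acoef y z * acoef x z = 0.
Proof.
move=> xy yz xz; rewrite !acoefE // 1?eq_sym //.
have h1 : ct y - ct x != 0 by rewrite subr_eq0 eq_sym.
have h2 : ct x - ct y != 0 by rewrite subr_eq0.
have h3 : ct z - ct y != 0 by rewrite subr_eq0 eq_sym.
have h4 : ct z - ct x != 0 by rewrite subr_eq0 eq_sym.
by field; rewrite q0 h1 h2 h3 h4.
Qed.

Lemma acoef_I2 x y z : ct x != ct y -> ct y != ct z -> ct x != ct z ->
  acoef y z * acoef x y + acoef x z * acoef z y - acoef x y * acoef x z = 0.
Proof.
move=> xy yz xz; rewrite !acoefE // 1?eq_sym //.
have h1 : ct y - ct x != 0 by rewrite subr_eq0 eq_sym.
have h2 : ct y - ct z != 0 by rewrite subr_eq0.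
have h3 : ct z - ct y != 0 by rewrite subr_eq0 eq_sym.
have h4 : ct z - ct x != 0 by rewrite subr_eq0 eq_sym.
by field; rewrite q0 h1 h2 h3 h4.
Qed.

Lemma acoef_I3 x y z : ct x != ct y -> ct y != ct z -> ct x != ct z ->
  acoef x y ^+ 2 * acoef y z + acoef x z * bcoef x y * bcoef y x
  - acoef y z ^+ 2 * acoef x y - acoef x z * bcoef y z * bcoef z y = 0.
Proof.
move=> xy yz xz; rewrite /bcoef !acoefE // 1?eq_sym //.
have h1 : ct y - ct x != 0 by rewrite subr_eq0 eq_sym.
have h1' : ct x - ct y != 0 by rewrite subr_eq0.
have h2 : ct y - ct z != 0 by rewrite subr_eq0.
have h3 : ct z - ct y != 0 by rewrite subr_eq0 eq_sym.
have h4 : ct z - ct x != 0 by rewrite subr_eq0 eq_sym.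
by field; rewrite q0 h1 h1' h2 h3 h4.
Qed.

Lemma seminormal_quad (k : 'I_n) : (0 < k)%N ->
  (M k - q%:M) * (M k + q^-1%:M) = 0.
Proof.
move=> k0; apply: mx_eq_e => L sL; rewrite mul0mx -mulmxE -mulmxA.
have f1 := M_e_pos sL k0; have f2 := M_e_swap sL k0; move: f1 f2 => /=.
have cxy : ct (tnth L (ord_pred k)) != ct (tnth L k).
  by apply: ct_distinct; rewrite // ord_predE //; lia.
set x := tnth L (ord_pred k) in cxy *; set y := tnth L k in cxy *.
have := acoefD cxy; rewrite /bcoef.
move: (acoef x y) (acoef y x) (e_ L) (e_ (swap_tab k L)) => a a' E E1 aD f1 f2.
rewrite [X in _ *m X]mulmxDl f1 mul_scalar_mx mulmxBl mul_scalar_mx.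
rewrite !mulmxDr -!scalemxAr f1.
move: (M k *m E1) f2 => W f2.
apply/colP => i; rewrite !mxE; move/colP/(_ i): f2; rewrite !mxE.
move: (W i _) (E i _) (E1 i _) => w v v1 /eqP; rewrite -subr_eq0 => /eqP f2.
rewrite -[RHS]f2; have -> : a' = q - q^-1 - a by rewrite -aD; ring.
by field.
Qed.

Lemma seminormal_braid (k l : 'I_n) : (0 < k)%N -> l = k.+1 :> nat ->
  M k * M l * M k = M l * M k * M l.
Proof.
move=> k0 lk; apply: mx_eq_e => L sL; rewrite -!mulmxE -!mulmxA.
have l0 : (0 < l)%N by rewrite lk.
have pl : ord_pred l = k by apply: ord_inj; rewrite ord_predE // lk.
have pk := ord_predE k0.
set p := ord_pred k in pk.
have pnk : p != k by apply/eqP => e; move: pk; rewrite e; lia.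
have pnl : p != l by apply/eqP => e; move: pk lk; rewrite e; lia.
have knl : k != l by apply/eqP => e; move: lk; rewrite e; lia.
pose L1 := swap_tab k L; pose L2 := swap_tab l L.
pose L12 := swap_tab l L1; pose L21 := swap_tab k L2.
pose L3 := swap_tab k L12.
pose x := tnth L p; pose y := tnth L k; pose z := tnth L l.
have t1p : tnth L1 p = y by rewrite tnth_swapL.
have t1k : tnth L1 k = x by rewrite tnth_swapR.
have t1l : tnth L1 l = z by rewrite tnth_swapD.
have t2p : tnth L2 p = x by rewrite tnth_swapD // ?pl eq_sym.
have t2k : tnth L2 k = z by rewrite -pl tnth_swapL.
have t2l : tnth L2 l = y by rewrite tnth_swapR pl.
have t12p : tnth L12 p = y by rewrite tnth_swapD // ?pl eq_sym.
have t12k : tnth L12 k = z by have := tnth_swapL L1 l; rewrite pl t1l.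
have t12l : tnth L12 l = x by rewrite tnth_swapR pl.
have t21p : tnth L21 p = z by rewrite tnth_swapL.
have t21k : tnth L21 k = x by rewrite tnth_swapR.
have t21l : tnth L21 l = y by rewrite tnth_swapD.
have t3p : tnth L3 p = z by rewrite tnth_swapL.
have t3k : tnth L3 k = y by rewrite tnth_swapR.
have t3l : tnth L3 l = x by rewrite tnth_swapD.
have L3E : swap_tab l L21 = L3.
  apply: eq_from_tnth => j.
  have [->|jp] := eqVneq j p; first by rewrite t3p tnth_swapD // ?pl eq_sym.
  have [->|jk] := eqVneq j k; first by rewrite t3k -[X in tnth _ X]pl tnth_swapL.
  have [->|jl] := eqVneq j l; first by rewrite t3l tnth_swapR pl.
  by rewrite !tnth_swapD // ?pl eq_sym.
have ltpk : (p < k)%N by rewrite pk; lia.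
have ltkl : (k < l)%N by rewrite lk.
have ltpl : (p < l)%N := ltn_trans ltpk ltkl.
have cxy : ct x != ct y by apply: ct_distinct => //; lia.
have cyz : ct y != ct z by apply: ct_distinct => //; lia.
have cxz : ct x != ct z by apply: ct_distinct => //; lia.
have f1 := M_e_pos sL k0; have f2 := M_e_pos sL l0.
have f3 := M_e_swap sL k0; have f4 := M_e_swap sL l0.
have f5 : M l *m e_ L1 = acoef x z *: e_ L1 + bcoef x z *: e_ L12.
  have := @M_e_weak L1 l l0; rewrite pl t1k t1l; apply.
  case: (swap_dich sL k0) => pre; [by left|right; split].
    by apply: (e0 ltpk); rewrite t1p t1k.
  by apply: (e0 ltpl); rewrite t12p t12l.
have f6 : M k *m e_ L2 = acoef x z *: e_ L2 + bcoef x z *: e_ L21.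
  have := @M_e_weak L2 k k0; rewrite -/p t2p t2k; apply.
  case: (swap_dich sL l0); rewrite ?pl => pre; [by left|right; split].
    by apply: (e0 ltkl); rewrite t2k t2l.
  by apply: (e0 ltpl); rewrite t21p t21l.
have f7 : M k *m e_ L12 = acoef y z *: e_ L12 + bcoef y z *: e_ L3.
  have := @M_e_weak L12 k k0; rewrite -/p t12p t12k; apply.
  case: (swap_dich sL k0) => [s1|pre]; last first.
    right; split; first by apply: (e0 ltpl); rewrite t12p t12l.
    by apply: (e0 ltkl); rewrite t3k t3l.
  case: (swap_dich s1 l0); rewrite ?pl => pre; [by left|right; split].
    by apply: (e0 ltkl); rewrite t12k t12l -t1k -t1l.
  by apply: (e0 ltpl); rewrite t3p t3l -t1k -t1l.
have f8 : M l *m e_ L21 = acoef x y *: e_ L21 + bcoef x y *: e_ L3.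
  have := @M_e_weak L21 l l0; rewrite pl t21k t21l L3E; apply.
  case: (swap_dich sL l0) => [s2|]; last first.
    rewrite pl => pre.
    right; split; first by apply: (e0 ltpl); rewrite t21p t21l.
    by apply: (e0 ltpk); rewrite t3p t3k.
  case: (swap_dich s2 k0); rewrite -/p => pre; [by left|right; split].
    by apply: (e0 ltpk); rewrite t21p t21k -t2p -t2k.
  by apply: (e0 ltpl); rewrite t3p t3l -t2p -t2k.
move: f1 f2 f3 f4 => /=; rewrite -/p pl -/x -/y -/z -/L1 -/L2 => f1 f2 f3 f4.
have I1 := acoef_I1 cxy cyz cxz; have I2 := acoef_I2 cxy cyz cxz.
have I3 := acoef_I3 cxy cyz cxz.
rewrite f1 f2 !mulmxDr -!scalemxAr f2 f5 f1 f6.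
rewrite !mulmxDr -!scalemxAr f1 f2 f6 f5 f7 f8.
move: (M k *m e_ L1) (M l *m e_ L2) f3 f4 {f1 f2 f5 f6 f7 f8} => W1 W2.
move: (e_ L) (e_ L1) (e_ L2) (e_ L12) (e_ L21) (e_ L3) => E E1 E2 E12 E21 E3.
move=> f3 f4; apply/colP => i; rewrite !mxE.
move/colP/(_ i): f3; move/colP/(_ i): f4; rewrite !mxE.
move: (E i _) (E1 i _) (E2 i _) (E12 i _) (E21 i _) (E3 i _) (W1 i _) (W2 i _).
move=> v v1 v2 v12 v21 v3 w1 w2 /eqP.
rewrite -subr_eq0 => /eqP g4 /eqP; rewrite -subr_eq0 => /eqP g3.
apply/eqP; rewrite -subr_eq0; apply/eqP.
transitivity (acoef x z * 0 - acoef x z * 0 + 0 * bcoef x y * v1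
  - 0 * bcoef y z * v2 + 0 * v); last by ring.
rewrite -{1}g3 -{1}g4 -{1}I1 -{1}I2 -{1}I3.
by ring.
Qed.

Lemma seminormal_comm (k l : 'I_n) : (k.+1 < l)%N -> M k * M l = M l * M k.
Proof.
move=> lkl; apply: mx_eq_e => L sL; rewrite -!mulmxE -!mulmxA.
have l0 : (0 < l)%N by apply: leq_ltn_trans lkl.
have pl := ord_predE l0.
have pnk : ord_pred l != k.
  by apply/eqP => e; move: pl lkl; rewrite e; lia.
have lnk : l != k by apply/eqP => e; move: lkl; rewrite e; lia.
have f2 := M_e_pos sL l0; move: f2 => /= f2.
have [k0|k0] := posnP k.
  have f1 : M k *m e_ L = ct (tnth L k) *: e_ L by rewrite M_e // k0.
  have f3 : M k *m e_ (swap_tab l L) = ct (tnth L k) *: e_ (swap_tab l L).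
    case: (swap_dich sL l0) => [s1|/(e_swap0 l0)->].
      by rewrite M_e // k0 /= tnth_swapD.
    by rewrite mulmx0 scaler0.
  rewrite f1 f2 mulmxDr -!scalemxAr f1 f2 f3 scalerDr !scalerA.
  by congr (_ *: _ + _ *: _); exact: mulrC.
have f1 := M_e_pos sL k0; move: f1 => /= f1.
have pk := ord_predE k0.
have pnl : ord_pred k != l.
  by apply/eqP => e; move: pk lkl; rewrite e; lia.
have knl : k != l by rewrite eq_sym.
have ppn : ord_pred k != ord_pred l.
  by apply/eqP => /(congr1 (@nat_of_ord n)); rewrite pk pl; lia.
have knp : k != ord_pred l by rewrite eq_sym.
have lnp : l != ord_pred k by rewrite eq_sym.
have ppn' : ord_pred l != ord_pred k by rewrite eq_sym.
pose L1 := swap_tab k L; pose L2 := swap_tab l L.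
have L12 : swap_tab k L2 = swap_tab l L1.
  apply: eq_from_tnth => j; rewrite !tnth_swap; congr tnth.
  have [->|j1] := eqVneq j (ord_pred k).
    by rewrite tpermL (tpermD pnk lnk) (tpermD ppn' lnp) tpermL.
  have [->|j2] := eqVneq j k.
    by rewrite tpermR (tpermD ppn' lnp) (tpermD pnk lnk) tpermR.
  have [->|j3] := eqVneq j (ord_pred l).
    by rewrite (tpermD ppn knp) !tpermL (tpermD pnl knl).
  have [->|j4] := eqVneq j l.
    by rewrite (tpermD pnl knl) !tpermR (tpermD ppn knp).
  by rewrite !tpermD // eq_sym.
have ltp : (ord_pred k < k)%N by rewrite pk prednK.
have ltpl : (ord_pred l < l)%N by rewrite pl prednK.
have f3 : M l *m e_ L1 =
    acoef (tnth L (ord_pred l)) (tnth L l) *: e_ L1 +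
    bcoef (tnth L (ord_pred l)) (tnth L l) *: e_ (swap_tab l L1).
  have := @M_e_weak L1 l l0; rewrite !tnth_swapD //; apply.
  case: (swap_dich sL k0) => pre; [by left|right; split].
    exact: e_swap0.
  by rewrite -L12; apply: (e0 ltp); rewrite tnth_swapL tnth_swapR !tnth_swapD.
have f4 : M k *m e_ L2 =
    acoef (tnth L (ord_pred k)) (tnth L k) *: e_ L2 +
    bcoef (tnth L (ord_pred k)) (tnth L k) *: e_ (swap_tab k L2).
  have := @M_e_weak L2 k k0; rewrite !tnth_swapD //; apply.
  case: (swap_dich sL l0) => pre; [by left|right; split].
    exact: e_swap0.
  by rewrite L12; apply: (e0 ltpl); rewrite tnth_swapL tnth_swapR !tnth_swapD.
rewrite f1 f2 !mulmxDr -!scalemxAr f1 f2 -/L1 -/L2 f3 f4 L12.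
apply/colP => i; rewrite !mxE; ring.
Qed.

Lemma seminormal_braid4 (k l : 'I_n) : k = 0%N :> nat -> l = 1%N :> nat ->
  M k * M l * M k * M l = M l * M k * M l * M k.
Proof.
move=> k0 l1; apply: mx_eq_e => L sL; rewrite -!mulmxE -!mulmxA.
have l0 : (0 < l)%N by rewrite l1.
have pl : ord_pred l = k by apply: ord_inj; rewrite ord_predE // l1 k0.
pose L1 := swap_tab l L; pose x := tnth L k; pose y := tnth L l.
have f2 := M_e_pos sL l0; have f3 := M_e_swap sL l0.
move: f2 f3 => /=; rewrite pl -/x -/y -/L1 => f2 f3.
have f1 : M k *m e_ L = ct x *: e_ L by rewrite M_e // k0.
have f4 : M k *m e_ L1 = ct y *: e_ L1.
  case: (swap_dich sL l0) => [s1|/(e_swap0 l0)->].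
    by rewrite M_e // k0 /= -[X in tnth _ X]pl tnth_swapL.
  by rewrite mulmx0 scaler0.
have cxy : ct x != ct y by apply: ct_distinct; rewrite // k0 l1.
have I : acoef x y * ct x + acoef y x * ct y = 0.
  have h1 : ct y - ct x != 0 by rewrite subr_eq0 eq_sym.
  have h2 : ct x - ct y != 0 by rewrite subr_eq0.
  rewrite !acoefE //; last by rewrite eq_sym.
  by field; rewrite q0 h1 h2.
have f5 : bcoef x y *: (M k *m (M l *m e_ L1)) =
    bcoef x y *: (acoef y x * ct y *: e_ L1 + bcoef y x * ct x *: e_ L).
  rewrite scalemxAr f3 -scalemxAr mulmxDr -!scalemxAr f1 f4.
  by rewrite !scalerA.
rewrite !(f1, f2, f4, mulmxDr, =^~ scalemxAr).
move: (M k *m (M l *m e_ L1)) f5 => W1 f5.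
move: (M l *m e_ L1) f3 {f1 f2 f4} => W2 f3; move: f3 f5.
move: (e_ L) (e_ L1) => E E1 f3 f5; apply/colP => i; rewrite !mxE.
move/colP/(_ i): f3; move/colP/(_ i): f5; rewrite !mxE.
move: (E i _) (E1 i _) (W1 i _) (W2 i _) => v v1 w1 w2 /eqP.
rewrite -subr_eq0 => /eqP g5 /eqP; rewrite -subr_eq0 => /eqP g3.
apply/eqP; rewrite -subr_eq0; apply/eqP.
transitivity (ct y * 0 - ct x * ct y * 0
  + 0 * bcoef x y * (ct y - ct x) * v1); last by ring.
rewrite -{1}g5 -{1}g3 -{1}I.
by ring.
Qed.

Lemma seminormal_cyclotomic (k : 'I_n) : k = 0%N :> nat ->
  \prod_(j < r) (M k - (u j)%:M) = 0.
Proof.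
move=> k0; apply: mx_eq_e => L sL; rewrite mul0mx.
have f1 : M k *m e_ L = ct (tnth L k) *: e_ L by rewrite M_e // k0.
have prodE (s : seq 'I_r) : (\prod_(j <- s) (M k - (u j)%:M)) *m e_ L =
    (\prod_(j <- s) (ct (tnth L k) - u j)) *: e_ L.
  elim: s => [|j s IHs]; first by rewrite !big_nil mul1mx scale1r.
  rewrite !big_cons -mulmxE -mulmxA IHs -scalemxAr mulmxBl f1 mul_scalar_mx.
  by rewrite -scalerBl scalerA mulrC.
rewrite prodE; have [U m h] := stdE sL.
set x := tnth L k; have xS : x \in S by rewrite -m mem_tnth.
have min z : z \in S -> box_before z x -> False.
  by rewrite -m => /tnthP[i ->] /h; rewrite k0.
have n0 : (0 < n)%N by apply: leq_ltn_trans (ltn_ord k).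
have r0 : row_of x = 0%N :> nat.
  apply/eqP; rewrite -leqn0 leqNgt; apply/negP => lt.
  pose z : box := (comp x, (Ordinal n0, col_of x)).
  apply: (min z); last exact: (@before_col _ _ z x).
  exact: (@diagram_down _ _ _ z _ xS erefl (ltnW lt) (leqnn _)).
have c0 : col_of x = 0%N :> nat.
  apply/eqP; rewrite -leqn0 leqNgt; apply/negP => lt.
  pose z : box := (comp x, (row_of x, Ordinal n0)).
  apply: (min z); last exact: (@before_row _ _ z x).
  exact: (@diagram_down _ _ _ z _ xS erefl (leqnn _) (ltnW lt)).
rewrite (bigD1 (comp x)) //= {1}/ct r0 c0 subrr mulr0 expr0z mulr1 subrr.
by rewrite mul0r scale0r.
Qed.

Lemma seminormal_relations : AK_relations_hold q u M.
Proof.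
apply: AK_relations_intro.
- exact: seminormal_comm.
- exact: seminormal_braid.
- exact: seminormal_braid4.
- exact: seminormal_cyclotomic.
- exact: seminormal_quad.
Qed.

End Relations.
End SeminormalForm.

Section WordsAndCharacters.

Variables (C : fieldType) (r n : nat).

Local Notation K := (ratfun C r).
Local Notation q := (qvar C r).
Local Notation u := (@uvar C r).

(* H_{r,n} over C(u_1, ..., u_r, q), with generators T_1, ..., T_n *)
Local Notation Hrn := (AKalg q u n).

Definition Tgen (i : nat) : Hrn := AKgen q u n i.

Definition telt (k : nat) : Hrn :=
  (\prod_(s <- rev (index_iota 2 k.+1)) Tgen s) * Tgen 1
  * \prod_(2 <= s < k.+1) Tgen s.

Definition Relt (i k l : nat) : Hrn :=
  telt k ^+ i * \prod_(k.+1 <= s < l.+1) Tgen s.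

Definition Sn_sequence (m : nat) (l : m.-tuple nat) : bool :=
  path ltn 0 l && (last 0%N l == n).

(* l_j for 0 <= j <= m, with the convention l_0 = 0 *)
Definition Sn_term (m : nat) (l : m.-tuple nat) (j : nat) : nat :=
  nth 0%N (0%N :: l) j.

Definition Telt (m : nat) (l : m.-tuple nat) (i : m.-tuple 'I_r) : Hrn :=
  \prod_(j < m) Relt (tnth i j) (Sn_term l j).+1 (Sn_term l j.+1).

Lemma seminormal_is_module (lam : rpart r n) :
  AK_relations_hold q u (seminormal q u (diagram lam)).
Proof.
apply: seminormal_relations; [exact: qvar_neq0|exact: uvar_neq0|].
by move=> k k' a a'; exact: uvar_qvar_sep.
Qed.

(* The representation of H_{r,n} on V^lambda, in the basis (v_L) *)
Definition Vrep (lam : rpart r n) : Hrn -> 'M[K]_#|stdtab n (diagram lam)| :=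
  AK_lift (seminormal_is_module lam).

Lemma Vrep_Tgen (lam : rpart r n) (k : 'I_n) :
  Vrep lam (Tgen k.+1) = seminormal q u (diagram lam) k.
Proof. exact: AK_lift_gen. Qed.

Definition chi (lam : rpart r n) (h : Hrn) : K := \tr (Vrep lam h).

Section Chains.

Variables (m : nat) (l : m.-tuple nat) (lam : rpart r n).
Variable mu : {ffun 'I_m.+1 -> rpart r n}.

(* mu^(j) / mu^(j-1) for j = 1, ..., m, numbered from 0 *)
Definition chain_step (j : 'I_m) : {set box r n} :=
  diagram (mu (lift ord0 j)) :\: diagram (mu (widen_ord (leqnSn m) j)).

Definition is_chain : bool :=
  [&& diagram (mu ord0) == set0, mu ord_max == lam &
   [forall j : 'I_m,
      (diagram (mu (widen_ord (leqnSn m) j)) \subset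
         diagram (mu (lift ord0 j)))
      && (#|chain_step j| == Sn_term l j.+1 - Sn_term l j)%N]].

End Chains.

End WordsAndCharacters.

Arguments Telt C {r} n {m} l i.
Arguments chi C {r n} lam h.
Arguments Sn_sequence n {m} l.

(* Main.v *)
(** Number the basis of V^lambda by standard tableaux L.  Two facts compute the
    diagonal entries of the word:
    - t_k acts diagonally, by ct(L(k)); this follows by induction from
      t_(k+1) = T_(k+1) t_k T_(k+1) and the quadratic relation;
    - in a product of distinct T_s in increasing order, the rightmost factor is
      the only one moving its label, so once it exchanges two labels no later
      factor can undo it: only the diagonal entry of each T_s contributes.
    So the entry at L is the product of the weights of the pieces of L between
    consecutive l_j.  Cutting L at the l_j is a bijection between standard
    tableaux of lambda and pairs of a chain of r-partitions and a standard
    tableau of each of its steps. *)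

Require Import Defs.
From mathcomp Require Import all_boot all_order all_algebra.
From mathcomp Require Import reals complex.
From mathcomp Require Import fingroup perm ring zify.

Set Implicit Arguments.
Unset Strict Implicit.
Unset Printing Implicit Defensive.

Import GRing.Theory.
Local Open Scope ring_scope.

(** * Diagonal entries of words in the seminormal matrices *)

Section DiagonalEntries.

Variables (K : fieldType) (r n : nat) (q : K) (u : 'I_r -> K).
Variable lam : rpart r n.

Hypotheses (q0 : q != 0) (u0 : forall k, u k != 0).
Hypothesis sep : forall (k k' : 'I_r) (a a' : nat),
  u k * q ^+ a = u k' * q ^+ a' -> k = k' /\ a = a'.

Local Notation S := (diagram lam).
Local Notation d := #|stdtab n S|.
Local Notation M := (seminormal q u S).

Let tab (a : 'I_d) : n.-tuple (box r n) := val (enum_val a).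

Let tab_inj : injective tab.
Proof. by move=> a b /val_inj/enum_val_inj. Qed.

Let tab_std a : is_standard S (tab a).
Proof. exact: valP (enum_val a). Qed.

Lemma mul_mx_e (A : 'M[K]_d) (a b : 'I_d) :
  (A *m e_ K lam (tab b)) a ord0 = A a b.
Proof.
rewrite !mxE (bigD1 b) //= mxE eqxx mulr1 big1 ?addr0 // => c /negPf cb.
by rewrite mxE (inj_eq tab_inj) cb mulr0.
Qed.

(** An operator that rearranges only the first [p] labels, counted from 0: the invariant kept while
    the word is built from left to right. *)
Definition fixes_from (p : nat) (A : 'M[K]_d) : Prop :=
  forall a b, A a b != 0 ->
  forall j : 'I_n, (p <= j)%N -> tnth (tab a) j = tnth (tab b) j.

Lemma fixes_fromS p p' A : (p <= p')%N -> fixes_from p A -> fixes_from p' A.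
Proof. by move=> le fA a b /fA f j lej; apply: f; apply: leq_trans lej. Qed.

Lemma fixes_from1 p : fixes_from p 1.
Proof. by move=> a b; rewrite mxE; case: (eqVneq a b) => [->|]; rewrite ?eqxx. Qed.

(** Right multiplication by a diagonal matrix rescales the columns, so it creates no new nonzero
    entry. *)
Lemma fixes_from_diag p (D : 'M[K]_d) (c : 'I_d -> K) A :
  (forall a b, D a b = c b *+ (a == b)) -> fixes_from p A ->
  fixes_from p (A * D) /\ (forall a, (A * D) a a = A a a * c a).
Proof.
move=> DE fA.
have E a b : (A * D) a b = A a b * c b.
  rewrite -mulmxE mxE (bigD1 b) //= DE eqxx mulr1n big1 ?addr0 // => x /negPf xb.
  by rewrite DE xb mulr0n mulr0.
split=> [a b|a]; rewrite E // mulf_eq0 negb_or => /andP[Aab _]; exact: fA.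
Qed.

(* A diagonal entry of A * T_(k+1) gets no contribution from the term v_(s L)
   of T_(k+1) v_L, because A cannot move the label k+1 back. *)
Lemma fixes_from_gen (k : 'I_n) A : (0 < k)%N -> fixes_from k A ->
  fixes_from k.+1 (A * M k) /\
  (forall a, (A * M k) a a = A a a * Tdiag q u k (tab a)).
Proof.
move=> k0 fA.
have ME c b : M k c b != 0 -> c = b \/ tab c = swap_tab k (tab b).
  rewrite mxE; cbv zeta; rewrite (gtn_eqF k0) -/(tab c) -/(tab b) (inj_eq tab_inj).
  case: (eqVneq c b) => [->|_]; first by left.
  by case: (tab c =P _) => [->|_]; [right | rewrite !mul0r addr0 eqxx].
have pk := ord_predE k0.
split=> [a b|a].
  rewrite -mulmxE mxE => /eqP ne j ltkj.
  have [c Ac] : exists c, A a c * M k c b != 0.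
    apply/existsP; apply/contra_notT: ne => /existsPn z.
    by apply: big1 => c _; apply/eqP; rewrite -[_ == _]negbK.
  move: Ac; rewrite mulf_eq0 negb_or => /andP[/fA fac /ME].
  rewrite (fac j (ltnW ltkj)) => -[-> //|->].
  rewrite tnth_swap tpermD //; apply: contraTneq ltkj => <-.
    by rewrite pk; lia.
  by rewrite ltnn.
rewrite -mulmxE mxE (bigD1 a) //= big1 ?addr0 => [|c ca].
  have [U _ _] := stdE (tab_std a).
  congr (_ * _); rewrite mxE; cbv zeta; rewrite (gtn_eqF k0) -/(tab a) eqxx mul1r.
  case: (tab a =P _) => [e|_]; last by rewrite mul0r addr0.
  have /(tuple_uniqP _ U)/(congr1 (@nat_of_ord n)) :
      tnth (tab a) k = tnth (tab a) (ord_pred k).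
    by rewrite {1}e tnth_swapR.
  by rewrite pk; lia.
apply/eqP; rewrite mulf_eq0; apply/orP; case: (eqVneq (A a c) 0) => [|Aac].
  by left.
right; apply/eqP; apply: contraTeq isT => /ME[e|e]; first by rewrite e eqxx in ca.
have [U _ _] := stdE (tab_std a).
have := fA _ _ Aac k (leqnn k); rewrite e tnth_swapR => /(tuple_uniqP _ U).
by move/(congr1 (@nat_of_ord n)); rewrite pk; lia.
Qed.

Variable T : nat -> 'M[K]_d.
Hypothesis T_gen : forall k : 'I_n, T k = M k.

(** As [T k] stands for T_(k+1), this is t_(k+1), a Jucys-Murphy element. *)
Definition murphy (k : nat) : 'M[K]_d :=
  (\prod_(s <- rev (index_iota 1 k.+1)) T s) * T 0 * \prod_(1 <= s < k.+1) T s.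

Lemma murphyS k : murphy k.+1 = T k.+1 * murphy k * T k.+1.
Proof.
have E : rev (index_iota 1 k.+2) = k.+1 :: rev (index_iota 1 k.+1).
  by rewrite /index_iota !subn1 -[k.+2.-1]addn1 iotaD rev_cat /= add1n.
by rewrite /murphy E big_cons (big_nat_recr k.+1) //= !mulrA.
Qed.

(** Let x, y be the boxes of the two labels exchanged in the induction step, a, a' the values
    [acoef x y], [acoef y x], and b, b' those of [bcoef]. The step comes down to a ct(x) + a' ct(y)
    = 0 and b b' = 1 + a a'. *)
Lemma murphy_e (k : 'I_n) (L : n.-tuple (box r n)) : is_standard S L ->
  murphy k *m e_ K lam L = ct q u (tnth L k) *: e_ K lam L.
Proof.
case: k => k; elim: k L => [|k IHk] L ltkn sL.
  rewrite /murphy /index_iota /= !big_nil mul1r mulr1.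
  by rewrite (T_gen (Ordinal ltkn)) M_e.
pose k' := Ordinal (ltnW ltkn); pose l := Ordinal ltkn.
have l0 : (0 < l)%N by [].
have pl : ord_pred l = k' by apply: ord_inj; rewrite ord_predE.
rewrite murphyS (T_gen l).
have f1 := M_e_pos q u sL l0; have f2 := M_e_swap q0 u0 sep sL l0.
have cxy : ct q u (tnth L k') != ct q u (tnth L l).
  by apply: (ct_distinct (lam := lam)) => //=; lia.
move: f1 f2 => /=; rewrite pl -/l -/k'.
set x := tnth L k' in cxy *; set y := tnth L l in cxy *.
move=> f1 f2.
have g1 : murphy k *m e_ K lam L = ct q u x *: e_ K lam L.
  exact: (IHk _ (ltnW ltkn)).
have g2 : murphy k *m e_ K lam (swap_tab l L) = ct q u y *: e_ K lam (swap_tab l L).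
  case: (swap_dich q0 sL l0) => [s1|pre].
    rewrite (IHk _ (ltnW ltkn) s1) -/k' /y; congr (ct q u _ *: _).
    by rewrite -(tnth_swapL L l) pl.
  by rewrite (e_swap0 _ _ l0 pre) mulmx0 scaler0.
move: (murphy k) g1 g2 => W g1 g2; rewrite -!mulmxE -!mulmxA.
rewrite f1 mulmxDr -!scalemxAr g1 g2 !mulmxDr -!scalemxAr f1.
(* [f2] gives the action of [M l] on the vector of the swapped tableau only up to the factor
   [bcoef x y], which is therefore moved next to it. *)
rewrite [X in _ + X]scalerA [_ * ct q u y]mulrC -[X in _ + X]scalerA f2.
have xy : ct q u y - ct q u x != 0 by rewrite subr_eq0 eq_sym.
have yx : ct q u x - ct q u y != 0 by rewrite subr_eq0.
apply/colP => i; rewrite !mxE /bcoef !(acoefE q0 u0) // 1?eq_sym //.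
by field; rewrite q0 xy yx.
Qed.

Lemma murphyE (k : 'I_n) a b :
  murphy k a b = ct q u (tnth (tab b) k) *+ (a == b).
Proof.
by rewrite -mul_mx_e murphy_e // !mxE (inj_eq tab_inj) mulr_natr.
Qed.

Lemma murphyXE (k : 'I_n) e a b :
  (murphy k ^+ e) a b = ct q u (tnth (tab b) k) ^+ e *+ (a == b).
Proof.
elim: e a b => [|e IHe] a b; first by rewrite !expr0 mxE.
rewrite exprSr -mulmxE mxE (bigD1 b) //= murphyE eqxx mulr1n IHe big1 ?addr0.
  by rewrite exprSr mulrnAl.
by move=> c /negPf cb; rewrite murphyE cb mulr0.
Qed.

Variable x0 : box r n.

(** The factors to the left of [T k] move only labels below [k], so [fixes_from_gen] applies to one
    factor after the other. The [maxn] covers an empty run. *)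
Lemma fixes_from_run A p l : (l <= n)%N -> fixes_from p.+1 A ->
  fixes_from (maxn p.+1 l) (A * \prod_(p.+1 <= k < l) T k) /\
  forall a, (A * \prod_(p.+1 <= k < l) T k) a a =
    A a a * \prod_(p.+1 <= k < l)
      acoef q u (nth x0 (tab a) k.-1) (nth x0 (tab a) k).
Proof.
elim: l => [|l IHl] ln fA.
  split=> [|a]; first by rewrite big_geq // mulr1 maxn0.
  by rewrite !big_geq // !mulr1.
case: (ltnP p l) => lpl; last first.
  rewrite !big_geq // mulr1; split=> [|a]; last by rewrite big_geq // mulr1.
  by rewrite (maxn_idPl _).
have [f E] := IHl (ltnW ln) fA.
rewrite !big_nat_recr // mulrA.
rewrite (maxn_idPr lpl) in f; rewrite (maxn_idPr _) 1?ltnW ?ltnS //.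
have l0 : (0 < Ordinal ln)%N by exact: leq_ltn_trans lpl.
have [f' E'] := fixes_from_gen l0 f.
rewrite -(T_gen (Ordinal ln)) /= in f' E'.
split=> // a; rewrite E' E big_nat_recr //= mulrA; congr (_ * _).
by rewrite /Tdiag /acoef !(tnth_nth x0) ord_predE.
Qed.

(** This is [Delta_tab] for a nonempty sequence whose length is not part of its type, as suits
    slices of a tableau. *)
Definition block_weight (e : nat) (s : seq (box r n)) : K :=
  ct q u (nth x0 s 0) ^+ e *
  \prod_(1 <= k < size s) acoef q u (nth x0 s k.-1) (nth x0 s k).

Lemma fixes_from_block A e p l : (p < l <= n)%N -> fixes_from p A ->
  let B := A * (murphy p ^+ e * \prod_(p.+1 <= k < l) T k) in
  fixes_from l B /\
  forall a, B a a = A a a * block_weight e (drop p (take l (tab a))).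
Proof.
move=> /andP[ltpl ln] fA B; have ltpn := leq_trans ltpl ln.
have [f E] := fixes_from_diag (murphyXE (Ordinal ltpn) e) fA.
have [f' E'] := fixes_from_run ln (fixes_fromS (leqnSn p) f).
rewrite (maxn_idPr ltpl) -mulrA in f'; split=> // a.
rewrite /B mulrA E' E -mulrA /block_weight; congr (_ * (_ * _)).
  by rewrite (tnth_nth x0) nth_drop addn0 nth_take.
(* Shift the product by [p]: position [k] of the slice is label [p + k] of the tableau. *)
rewrite size_drop size_takel ?size_tuple // -add1n big_addn.
apply: eq_big_nat => k /andP[k0 klt].
by rewrite !nth_drop !nth_take 1?addnC; [congr (acoef _ _ (nth _ _ _) _)|..]; lia.
Qed.

Lemma fixes_from_blocks (m : nat) (l e : nat -> nat) :
  (forall j, (j < m)%N -> (l j < l j.+1)%N) -> (l m <= n)%N ->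
  let B := \prod_(j < m)
    (murphy (l j) ^+ e j * \prod_((l j).+1 <= k < l j.+1) T k) in
  fixes_from (l m) B /\
  forall a, B a a =
    \prod_(j < m) block_weight (e j) (drop (l j) (take (l j.+1) (tab a))).
Proof.
elim: m => [|m IHm] lt ln /=.
  by rewrite big_ord0; split=> [|a]; [exact: fixes_from1|rewrite big_ord0 mxE eqxx].
have ltm := lt _ (ltnSn m).
have [|f E] := IHm (fun j h => lt j (ltnW h)) _; first exact: ltnW (leq_trans _ ln).
rewrite big_ord_recr /=.
have [|f' E'] := @fixes_from_block _ (e m) (l m) (l m.+1) _ f; first by rewrite ltm.
by split=> // a; rewrite E' E big_ord_recr.
Qed.

End DiagonalEntries.

(** * Diagrams as down-closed sets, and standard fillings *)

Section Shapes.

Variables (r n : nat).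
Local Notation box := (box r n).

Implicit Types (S : {set box}) (s : seq box) (x y : box) (mu : rpart r n).

Definition down_closed S : Prop :=
  forall x y, box_before y x -> x \in S -> y \in S.

Lemma box_beforexx x : box_before x x = false.
Proof. by rewrite /box_before !ltnn !andbF. Qed.

Lemma diagram_down_closed mu : down_closed (diagram mu).
Proof.
move=> x y /andP[/eqP ec /orP[]] /andP[/eqP e lt] xS;
  by apply: diagram_down xS ec _ _; rewrite ?e // ltnW.
Qed.

(** If a row is longer in [mu] than in [mu'], its box just past the end of the shorter row lies in
    only one of the diagrams. *)
Lemma diagram_inj : injective (@diagram r n).
Proof.
have le mu mu' : diagram mu = diagram mu' ->
    forall c i, (tnth (val (mu c)) i <= tnth (val (mu' c)) i)%N.
  move=> e c i; rewrite leqNgt; apply/negP => lt.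
  have ltn : (tnth (val (mu' c)) i < n)%N.
    by apply: leq_trans lt _; rewrite -ltnS ltn_ord.
  have : (c, (i, Ordinal ltn)) \in diagram mu by rewrite inE.
  by rewrite e inE /= ltnn.
move=> mu mu' e; apply/ffunP => c; apply/val_inj/eq_from_tnth => i.
by apply/val_inj/eqP; rewrite /= eqn_leq !le.
Qed.

Lemma card_ord_ltn (k m : nat) : (m <= k)%N -> #|[set j : 'I_k | (j < m)%N]| = m.
Proof.
by move=> le; rewrite cardsE -sum1_card (big_ord_narrow le) sum1_card card_ord.
Qed.

(** By counting: [J] contains the first [j.+1] ordinals if [j] is in [J], and is contained in the
    first [j] ones otherwise. *)
Lemma initial_setE (k : nat) (J : {set 'I_k}) :
  (forall i j : 'I_k, (i <= j)%N -> j \in J -> i \in J) ->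
  forall j, (j \in J) = (j < #|J|)%N.
Proof.
move=> down j; apply/idP/idP => [jJ|].
  rewrite -{1}(card_ord_ltn (ltn_ord j)) subset_leq_card //.
  by apply/subsetP => i; rewrite inE ltnS => /down; apply.
apply: contraTT => jJ; rewrite -leqNgt -(card_ord_ltn (ltnW (ltn_ord j))).
apply/subset_leq_card/subsetP => i iJ; rewrite inE ltnNge.
by apply: contra jJ => /down; apply.
Qed.

Lemma down_closedP S x y : down_closed S -> x \in S -> Defs.comp y = Defs.comp x ->
  (row_of y <= row_of x)%N -> (col_of y <= col_of x)%N -> y \in S.
Proof.
move=> down xS ec er el.
(* The corner of the path from [x] to [y]: first up the column of [x], then left along the row of
   [y]. *)
have zS : (Defs.comp x, (row_of y, col_of x)) \in S.
  move: er; rewrite leq_eqVlt => /orP[/eqP/val_inj ->|lt].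
    by case: x xS {ec el} => ? [].
  by apply: down xS; exact: before_col.
move: el; rewrite leq_eqVlt => /orP[/eqP/val_inj el|lt].
  by rewrite -ec -el in zS; case: y zS {ec er el} => ? [].
by apply: down zS; exact: before_row.
Qed.

(** The parts count the boxes of [S] in each row. Down-closure makes them weakly decreasing and
    makes each row an initial segment of columns. *)
Lemma down_closed_diagram S : down_closed S -> exists mu, diagram mu = S.
Proof.
move=> down.
pose J c i := [set j : 'I_n | (c, (i, j)) \in S].
have Jle c i : (#|J c i| < n.+1)%N by rewrite ltnS -[leqRHS]card_ord max_card.
pose p c := [tuple Ordinal (Jle c i) | i < n].
have psort c : sorted geq [seq nat_of_ord k | k <- p c].
  have sz : size (p c) = n by rewrite size_tuple.
  apply/(sortedP 0%N) => i; rewrite size_map sz => ltin.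
  have o : 'I_n.+1 by exact: ord0.
  rewrite !(nth_map o) ?sz // 1?ltnW //.
  have pE k (lt : (k < n)%N) : nth o (p c) k = #|J c (Ordinal lt)| :> nat.
    by rewrite -[k]/(nat_of_ord (Ordinal lt)) -tnth_nth tnth_mktuple.
  rewrite (pE _ ltin) (pE _ (ltnW ltin)) /geq /=; apply/subset_leq_card/subsetP => j.
  by rewrite !inE => jS; apply: down_closedP jS _ _ _ => //=.
exists [ffun c => exist _ (p c) (psort c)].
apply/setP => -[c [i j]]; rewrite inE ffunE /= tnth_mktuple /=.
rewrite -initial_setE ?inE // => j1 j2 le; rewrite !inE => jS.
exact: down_closedP jS _ _ _.
Qed.

(** In [pairwise] form the order condition splits along a concatenation. *)
Lemma is_standardE S s :
  is_standard S s = [&& uniq s, [forall x, (x \in s) == (x \in S)] &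
                        pairwise (fun x y => ~~ box_before y x) s].
Proof.
case U : (uniq s); last by rewrite /is_standard U.
rewrite /is_standard U /=; case: forallP => //= m.
have {}m x : (x \in S) = (x \in s) by rewrite (eqP (m x)).
case: s => [|x0 s] in U m *.
  by apply/forall_inP => x; rewrite m.
apply/forall_inP/(pairwiseP x0) => [h i j ltis ltjs ltij|h x].
  have xs k : (k < size (x0 :: s))%N -> nth x0 (x0 :: s) k \in S.
    by move=> lt; rewrite m mem_nth.
  have /forall_inP/(_ _ (xs _ ltis))/implyP := h _ (xs _ ltjs).
  by rewrite !index_uniq // => /contraNN; apply; rewrite -leqNgt ltnW.
rewrite m => xs; apply/forall_inP => y; rewrite m => ys.
apply/implyP; apply: contraTltn; rewrite leq_eqVlt => /orP[/eqP e|lt].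
  have -> : x = y by rewrite -(nth_index x0 xs) -e nth_index.
  by rewrite box_beforexx.
have := h _ _ _ _ lt; rewrite !inE !index_mem !nth_index //; exact.
Qed.

(** The order condition across the cut is automatic: a box before one of the down-closed set [S1] is
    itself in [S1]. *)
Lemma is_standard_cat S1 S2 s1 s2 : down_closed S1 -> S1 \subset S2 ->
  is_standard S1 s1 -> is_standard S2 (s1 ++ s2) = is_standard (S2 :\: S1) s2.
Proof.
move=> down sub; rewrite !is_standardE cat_uniq pairwise_cat.
case/and3P => -> /forallP m ->; rewrite /=.
have {}m x : (x \in s1) = (x \in S1) by apply/eqP.
apply/and3P/and3P => [[/andP[/hasPn dis ->] /forallP m2 /andP[_ ->]]|].
  split=> //; apply/forallP => x; rewrite inE -(eqP (m2 x)) mem_cat -m.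
  by case: (boolP (x \in s2)) => [/dis /= ->|_]; case: (x \in s1).
case=> -> /forallP m2 ->; split=> //.
- rewrite andbT; apply/hasPn => x; rewrite (eqP (m2 x)) inE => /andP[xS1 _].
  by rewrite /= m.
- apply/forallP => x; rewrite mem_cat m (eqP (m2 x)) inE.
  by case: (boolP (x \in S1)) => // /(subsetP sub) ->.
- rewrite andbT; apply/allrelP => x y; rewrite m (eqP (m2 y)) inE => xS /andP[yS _].
  by apply: contra yS => /down; apply.
Qed.

(** A box before one of [s1] belongs to [S], hence to the filling, and the order condition keeps it
    out of [s2]. *)
Lemma is_standard_prefix S s1 s2 : down_closed S -> is_standard S (s1 ++ s2) ->
  down_closed [set x in s1] /\ is_standard [set x in s1] s1.
Proof.
rewrite !is_standardE cat_uniq pairwise_cat => down.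
case/and3P => /and3P[-> _ _] /forallP m /and3P[/allrelP h12 h1 _].
split=> [x y|]; last by rewrite h1 andbT; apply/forallP => x; rewrite inE.
rewrite !inE => yx xs1.
have /(down _ _ yx) : x \in S by rewrite -(eqP (m x)) mem_cat xs1.
rewrite -(eqP (m y)) mem_cat => /orP[//|ys2].
by have := h12 _ _ xs1 ys2; rewrite yx.
Qed.

Lemma is_standard_inj S1 S2 s : is_standard S1 s -> is_standard S2 s -> S1 = S2.
Proof.
case/and3P => _ /forallP m1 _ /and3P[_ /forallP m2 _].
by apply/setP => x; rewrite -(eqP (m1 x)) (eqP (m2 x)).
Qed.

Lemma is_standard_size S s : is_standard S s -> size s = #|S|.
Proof.
case/and3P => U /forallP m _; rewrite -(card_uniqP U).
by apply: eq_card => x; rewrite (eqP (m x)).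
Qed.

Lemma is_standard_nil : is_standard (set0 : {set box}) [::].
Proof. by rewrite is_standardE /= andbT; apply/forallP => x; rewrite !inE. Qed.

(** Bounded sequences put fillings of all sizes in one finite type, so that tableaux and families of
    their slices can be reindexed. *)
Lemma sum_stdtab (V : nmodType) S (N : nat) (F : seq box -> V) :
    #|S| = N -> (N <= n)%N ->
  \sum_(L : stdtab N S) F (tval (val L)) =
  \sum_(s : n.-bseq box | is_standard S s) F s.
Proof.
move=> cS lN.
have le (L : stdtab N S) : (size (tval (val L)) <= n)%N by rewrite size_tuple.
pose h L := Bseq (le L).
(* Partial inverse of [h]: it tests the length first, then standardness. *)
pose h' (s : n.-bseq box) : option (stdtab N S) :=
  obind insub (insub (s : seq box) : option (N.-tuple box)).
rewrite (reindex_omap h h') => [|s sS].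
  apply: eq_bigl => L; rewrite /h' /= valK /= valK eqxx andbT.
  by rewrite (valP L).
have sN : size s == N by rewrite (is_standard_size sS) cS.
rewrite /h' insubT /= insubT /=.
by congr Some; apply: val_inj.
Qed.

End Shapes.

(** * Cutting a sequence at given positions *)

Section Slices.

Variable T : Type.

Lemma size_flatten_take (ss : seq (seq T)) (l : nat -> nat) : l 0 = 0%N ->
  (forall j, (j < size ss)%N -> l j.+1 = l j + size (nth [::] ss j))%N ->
  forall k, (k <= size ss)%N -> size (flatten (take k ss)) = l k.
Proof.
move=> l0 lS; elim=> [|k IHk] ltk; first by rewrite take0 l0.
by rewrite (take_nth [::]) // flatten_rcons size_cat IHk 1?ltnW // lS.
Qed.

(** Together with [flatten_slices], this makes concatenation and cutting at the partial sums of the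
    lengths inverse to each other. *)
Lemma flatten_slice (ss : seq (seq T)) (l : nat -> nat) : l 0 = 0%N ->
  (forall j, (j < size ss)%N -> l j.+1 = l j + size (nth [::] ss j))%N ->
  forall j, (j < size ss)%N ->
  drop (l j) (take (l j.+1) (flatten ss)) = nth [::] ss j.
Proof.
move=> l0 lS j ltj.
have -> : flatten ss = flatten (take j ss) ++ nth [::] ss j ++ flatten (drop j.+1 ss).
  by rewrite -[ss in LHS](cat_take_drop j) flatten_cat (drop_nth [::]).
rewrite lS // takeD -(size_flatten_take l0 lS (ltnW ltj)) take_size_cat //.
by rewrite !drop_size_cat // take_size_cat.
Qed.

Lemma cat_take_slice (s : seq T) (a b : nat) : (a <= b)%N ->
  take b s = take a s ++ drop a (take b s).
Proof. by move=> le; rewrite -[LHS](cat_take_drop a) take_takel. Qed.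

Lemma flatten_slices (s : seq T) (l : nat -> nat) (m : nat) :
  l 0 = 0%N -> (forall j, (j < m)%N -> (l j <= l j.+1)%N) ->
  flatten (mkseq (fun j => drop (l j) (take (l j.+1) s)) m) = take (l m) s.
Proof.
move=> l0; elim: m => [|m IHm] le; first by rewrite l0 take0.
rewrite mkseqS flatten_rcons IHm => [|j lt]; last by rewrite le // ltnW.
by rewrite -cat_take_slice // le.
Qed.

End Slices.

Lemma insubK_bseq (T : Type) (n : nat) (s : seq T) :
  (size s <= n)%N -> insub_bseq n s = s :> seq T.
Proof. by move=> le; rewrite [LHS]val_insubd le. Qed.

(** * Standard tableaux and chains of r-partitions *)

Section Chains.

Variables (r n m : nat) (lseq : m.-tuple nat) (lam : rpart r n).
Hypothesis Sn_lseq : Sn_sequence n lseq.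

Local Notation box := (box r n).
Local Notation l := (Sn_term lseq).
Local Notation slice s j := (drop (l j) (take (l j.+1) s)).

Lemma Sn_term_ltS (j : nat) : (j < m)%N -> (l j < l j.+1)%N.
Proof.
case/andP: Sn_lseq => /(pathP 0%N) h _ lt.
by apply: (h j); rewrite size_tuple.
Qed.

Lemma Sn_term_last : l m = n.
Proof.
case/andP: Sn_lseq => _ /eqP <-.
by rewrite /Sn_term -[last _ _]/(last 0%N (0%N :: lseq)) -nth_last /= size_tuple.
Qed.

Lemma Sn_term_leq (j : nat) : (j <= m)%N -> (l j <= n)%N.
Proof.
move=> /subKn <-; elim: (m - j)%N => [|k IHk]; first by rewrite subn0 Sn_term_last.
apply: leq_trans IHk; case: (ltnP k m) => [lt|le]; last first.
  (* Here truncated subtraction makes both indices 0. *)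
  by have -> : (m - k.+1 = m - k)%N by lia.
have -> : (m - k = (m - k.+1).+1)%N by lia.
by apply/ltnW/Sn_term_ltS; lia.
Qed.

Hypothesis card_lam : #|diagram lam| = n.

(** The incidence relation between fillings and chains along which the two summations are
    exchanged. *)
Definition cut_along (mu : {ffun 'I_m.+1 -> rpart r n}) (s : seq box) : bool :=
  [forall j : 'I_m.+1, is_standard (diagram (mu j)) (take (l j) s)].

(** Each prefix of a standard filling occupies a down-closed set, which is the diagram of exactly
    one r-partition. *)
Lemma cut_along_unique (s : seq box) : is_standard (diagram lam) s ->
  exists mu0, forall mu, cut_along mu s = (mu == mu0).
Proof.
move=> sS.
have /fin_all_exists[f fE] : forall j : 'I_m.+1, exists mu : rpart r n,
    is_standard (diagram mu) (take (l j) s).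
  move=> j; move: sS; rewrite -{1}(cat_take_drop (l j) s).
  case/(is_standard_prefix (@diagram_down_closed _ _ _)) => /down_closed_diagram[mu <-].
  by exists mu.
exists (finfun f) => mu; apply/forallP/eqP => [h|-> j]; last by rewrite ffunE.
apply/ffunP => j; rewrite ffunE; apply: diagram_inj.
exact: is_standard_inj (h j) (fE j).
Qed.

Lemma widen_Ordinal (j : 'I_m) (lt : (j < m.+1)%N) :
  widen_ord (leqnSn m) j = Ordinal lt.
Proof. exact: val_inj. Qed.

Lemma lift0_Ordinal (j : 'I_m) (lt : (j.+1 < m.+1)%N) : lift ord0 j = Ordinal lt.
Proof. exact: val_inj. Qed.

Lemma take_SnS (s : seq box) (j : 'I_m) :
  take (l j.+1) s = take (l j) s ++ slice s j.
Proof. by rewrite -cat_take_slice // ltnW // Sn_term_ltS. Qed.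

Lemma cut_along_chain mu (s : seq box) :
  is_standard (diagram lam) s -> cut_along mu s -> is_chain lseq lam mu.
Proof.
move=> sS /forallP h; have szs := is_standard_size sS; rewrite card_lam in szs.
apply/and3P; split.
- have := h ord0; rewrite take0 => h0.
  by apply/eqP; exact: is_standard_inj h0 (is_standard_nil _ _).
- have := h ord_max; rewrite /= Sn_term_last take_oversize ?szs // => hn.
  by apply/eqP/diagram_inj; exact: is_standard_inj hn sS.
- apply/forallP => j.
  have h1 := h (widen_ord (leqnSn m) j); have h2 := h (lift ord0 j).
  rewrite lift0 take_SnS /= in h2; rewrite /= in h1.
  have sub : diagram (mu (widen_ord (leqnSn m) j)) \subset
      diagram (mu (lift ord0 j)).
    case/and3P: h1 => _ /forallP m1 _; case/and3P: h2 => _ /forallP m2 _.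
    by apply/subsetP => x; rewrite -(eqP (m1 x)) -(eqP (m2 x)) mem_cat => ->.
  rewrite sub /chain_step cardsDS //= -(is_standard_size h1) -(is_standard_size h2).
  have le : (l j.+1 <= size s)%N by rewrite szs Sn_term_leq.
  by rewrite -take_SnS !size_takel // (leq_trans _ le) // ltnW // Sn_term_ltS.
Qed.

(** By [is_standard_cat], a standard prefix extends to the next one exactly by a standard slice.
    Conversely, induction builds up the prefixes until [l m = n], where the prefix is all of [s]. *)
Lemma chain_slicesE mu (s : seq box) : is_chain lseq lam mu -> (size s <= n)%N ->
  is_standard (diagram lam) s && cut_along mu s =
  [forall j : 'I_m, is_standard (chain_step mu j) (slice s j)].
Proof.
case/and3P => /eqP mu0 /eqP mum /forallP steps szs.
apply/andP/forallP => [[sS /forallP h] j|h].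
  have h1 := h (widen_ord (leqnSn m) j); have h2 := h (lift ord0 j).
  have [sub _] := andP (steps j).
  rewrite lift0 take_SnS in h2.
  by rewrite -(is_standard_cat _ (@diagram_down_closed _ _ _) sub h1).
have H k (lt : (k < m.+1)%N) : is_standard (diagram (mu (Ordinal lt))) (take (l k) s).
  elim: k lt => [|k IHk] lt.
    by rewrite take0 (_ : Ordinal lt = ord0) ?mu0 ?is_standard_nil //; exact: val_inj.
  pose j : 'I_m := Ordinal (lt : (k < m)%N).
  have [sub _] := andP (steps j).
  have h1 := IHk (ltnW lt); rewrite -(widen_Ordinal (j := j)) in h1.
  rewrite -(lift0_Ordinal (j := j)) -[k]/(nat_of_ord j) take_SnS.
  by rewrite (is_standard_cat _ (@diagram_down_closed _ _ _) sub h1) h.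
split; last by apply/forallP => -[].
have := H m (ltnSn m); rewrite Sn_term_last take_oversize //.
by rewrite (_ : Ordinal _ = ord_max) ?mum //; exact: val_inj.
Qed.

(** Each tableau has one chain, so a sum over chains can be inserted and moved outside. For a fixed
    chain the product of sums expands over families of slices, and these correspond to the tableaux
    cut along it. *)
Lemma sum_standard_chains (V : comPzSemiRingType) (g : 'I_m -> seq box -> V) :
  \sum_(s : n.-bseq box | is_standard (diagram lam) s) \prod_(j < m) g j (slice s j) =
  \sum_(mu : {ffun 'I_m.+1 -> rpart r n} | is_chain lseq lam mu)
    \prod_(j < m) \sum_(s : n.-bseq box | is_standard (chain_step mu j) s) g j s.
Proof.
transitivity (\sum_(s : n.-bseq box | is_standard (diagram lam) s)
    \sum_(mu | cut_along mu s) \prod_(j < m) g j (slice s j)).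
  apply: eq_bigr => s sS; have [mu0 E] := cut_along_unique sS.
  by rewrite (eq_bigl _ _ E) big_pred1_eq.
rewrite (exchange_big_dep (is_chain lseq lam)) => [|s mu]; last first.
  exact: cut_along_chain.
apply: eq_bigr => mu chain_mu; rewrite bigA_distr_big_dep.
(* [h] cuts and [h'] glues. [insub_bseq] falls back to the empty sequence on input that is too long.
   This does not occur for slices, nor when gluing standard fillings of the steps, whose sizes add
   up to [n]. *)
pose h (s : n.-bseq box) : {ffun 'I_m -> n.-bseq box} :=
  [ffun j : 'I_m => insub_bseq n (slice s j)].
pose blocks (f : {ffun 'I_m -> n.-bseq box}) := [seq (f j : seq box) | j <- enum 'I_m].
pose h' (f : {ffun 'I_m -> n.-bseq box}) : n.-bseq box :=
  insub_bseq n (flatten (blocks f)).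
have sz_slice (s : n.-bseq box) a b : (size (drop a (take b s)) <= n)%N.
  by rewrite size_drop size_take_min; apply: leq_trans (size_bseq s); lia.
have hE s (j : 'I_m) : h s j = slice s j :> seq box.
  by rewrite ffunE insubK_bseq // sz_slice.
have h'K s : h' (h s) = s.
  rewrite /h'.
  have -> : blocks (h s) = mkseq (fun j => slice s j) m.
    rewrite /mkseq -val_enum_ord -map_comp.
    by apply: eq_map => j; rewrite /= hE.
  rewrite flatten_slices // => [|j /Sn_term_ltS/ltnW //].
  rewrite Sn_term_last take_oversize ?size_bseq //.
  by apply: val_inj; exact: insubK_bseq (size_bseq s).
have h'_inv (f : {ffun 'I_m -> n.-bseq box}) :
    f \in family (fun j (s : n.-bseq box) => is_standard (chain_step mu j) s) ->
    h (h' f) = f.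
  move=> /familyP fS.
  have size_blocks : size (blocks f) = m by rewrite size_map size_enum_ord.
  have nth_blocks (j : 'I_m) : nth [::] (blocks f) j = f j.
    by rewrite (nth_map j) ?size_enum_ord // nth_ord_enum.
  have lS j : (j < size (blocks f))%N ->
      l j.+1 = (l j + size (nth [::] (blocks f) j))%N.
    rewrite size_blocks => lt; have /is_standard_size := fS (Ordinal lt).
    rewrite (nth_blocks (Ordinal lt)) => ->.
    have /and3P[_ _ /forallP/(_ (Ordinal lt))/andP[_ /eqP->]] := chain_mu.
    by rewrite subnKC // ltnW // Sn_term_ltS.
  apply/ffunP => j; apply: val_inj; rewrite [LHS]hE.
  have szl : (size (flatten (blocks f)) <= n)%N.
    by rewrite -[blocks f]take_size (size_flatten_take _ lS) ?size_blocks ?Sn_term_last.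
  rewrite insubK_bseq //.
  by rewrite (flatten_slice _ lS) ?size_blocks // nth_blocks.
rewrite (reindex_onto h h') //; apply: eq_big => [s|s _]; last first.
  by apply: eq_bigr => j _; rewrite hE.
rewrite h'K eqxx andbT chain_slicesE ?size_bseq //.
by apply/forallP/familyP => H j; have := H j; rewrite unfold_in hE.
Qed.

End Chains.

(** * [Delta] as a sum of block weights *)

Section Weights.

Variables (K : fieldType) (r n : nat) (q : K) (u : 'I_r -> K) (x0 : box r n).

(** At [N = 0] the defaults would differ: [head] returns [0], while [nth] returns the box [x0]. *)
Lemma Delta_tabE e N (L : N.-tuple (box r n)) : (0 < N)%N ->
  Delta_tab q u e L = block_weight q u x0 e L.
Proof.
move=> N0; rewrite /Delta_tab /block_weight size_tuple; congr (_ ^+ _ * _).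
  by rewrite -nth0 (nth_map x0) ?size_tuple.
rewrite big_geq_mkord; apply: eq_bigr => k /= k0.
by rewrite /Tdiag /acoef !(tnth_nth x0) ord_predE.
Qed.

Lemma DeltaE e (S : {set box r n}) : (0 < #|S| <= n)%N ->
  Delta q u e S =
  \sum_(s : n.-bseq (box r n) | is_standard S s) block_weight q u x0 e s.
Proof.
case/andP => S0 Sn; rewrite -(sum_stdtab _ erefl) //.
by apply: eq_bigr => L _; exact: Delta_tabE.
Qed.

End Weights.

(** * The character on a word as a sum over tableaux *)

Section Words.

Variables (C : fieldType) (r n : nat) (lam : rpart r n).

Let T (k : nat) := Vrep (C := C) lam (Tgen C r n k.+1).

Let V1 : Vrep (C := C) lam 1 = 1.
Proof. exact: (AK_lift_monoid_morphism _).1. Qed.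

Let VM : {morph Vrep (C := C) lam : x y / x * y}.
Proof. exact: (AK_lift_monoid_morphism _).2. Qed.

Let VX x e : Vrep (C := C) lam (x ^+ e) = Vrep lam x ^+ e.
Proof. by elim: e => [|e IHe]; rewrite ?expr0 ?V1 // !exprS VM IHe. Qed.

Let V_prod := big_morph (Vrep (C := C) lam) VM V1.

Lemma Vrep_telt k : Vrep lam (telt C r n k.+1) = murphy T k.
Proof.
rewrite /telt /murphy !VM !V_prod big_add1; congr (_ * _ * _).
(* Generators count from 1 in [telt] and from 0 in [murphy]; for the reversed product the shift is
   made on the list itself. *)
have -> : index_iota 2 k.+2 = map S (index_iota 1 k.+1).
  by rewrite /index_iota !subSS -(iotaDl 1 1).
by rewrite -map_rev big_map.
Qed.

Lemma Vrep_Telt m (l : m.-tuple nat) (i : m.-tuple 'I_r) :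
  Vrep lam (Telt C n l i) =
  \prod_(j < m) (murphy T (Sn_term l j) ^+ tnth i j *
    \prod_((Sn_term l j).+1 <= k < Sn_term l j.+1) T k).
Proof.
rewrite /Telt V_prod; apply: eq_bigr => j _.
by rewrite /Relt VM VX Vrep_telt V_prod big_add1.
Qed.

Lemma chiE (x0 : box r n) m (l : m.-tuple nat) (i : m.-tuple 'I_r) :
  Sn_sequence n l ->
  chi C lam (Telt C n l i) =
  \sum_(L : stdtab n (diagram lam))
    \prod_(j < m) block_weight (qvar C r) (@uvar C r) x0 (tnth i j)
      (drop (Sn_term l j) (take (Sn_term l j.+1) (val L))).
Proof.
move=> Snl; rewrite /chi Vrep_Telt /mxtrace.
rewrite (reindex enum_rank) /=; last by apply: onW_bij; exact: enum_rank_bij.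
apply: eq_bigr => L _.
(* The exponents are extended by 0 beyond [m], since [fixes_from_blocks] inducts on [m] and takes
   them on all naturals. *)
pose e j := oapp (fun k => nat_of_ord (tnth i k)) 0%N (insub j).
have eE (j : 'I_m) : e j = tnth i j by rewrite /e valK.
under eq_bigr do rewrite -eE.
have [_ ->] := fixes_from_blocks (qvar_neq0 C r) (@uvar_neq0 C r)
  (fun k k' a a' => @uvar_qvar_sep C r a a' k k') (T := T) (@Vrep_Tgen C r n lam) x0 e
  (Sn_term_ltS Snl) (Sn_term_leq Snl (leqnn m)).
by apply: eq_bigr => j _; rewrite eE enum_rankK.
Qed.

End Words.

Theorem theorem2p15 (R : realType) (r n : nat) (r_gt0 : (0 < r)%N)
    (n_gt0 : (0 < n)%N) (m : nat) (lseq : m.-tuple nat) (iseq : m.-tuple 'I_r)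
    (lam : rpart r n) :
  Sn_sequence n lseq ->
  #|diagram lam| = n ->
  chi R[i] lam (Telt R[i] n lseq iseq) =
  \sum_(mu : {ffun 'I_m.+1 -> rpart r n} | is_chain lseq lam mu)
     \prod_(j < m)
        Delta (qvar R[i] r) (@uvar R[i] r) (tnth iseq j) (chain_step mu j).
Proof.
move=> Snl cl.
(* Positivity of [r] and [n] provides a box to serve as the default of [nth]. *)
pose x0 : box r n := (Ordinal r_gt0, (Ordinal n_gt0, Ordinal n_gt0)).
rewrite (chiE R[i] lam x0 iseq Snl).
rewrite (sum_stdtab (fun s => \prod_(j < m) block_weight (qvar R[i] r)
  (@uvar R[i] r) x0 (tnth iseq j)
  (drop (Sn_term lseq j) (take (Sn_term lseq j.+1) s))) cl (leqnn n)).
rewrite (sum_standard_chains Snl cl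
  (fun j => block_weight (qvar R[i] r) (@uvar R[i] r) x0 (tnth iseq j))).
apply: eq_bigr => mu chain_mu; apply: eq_bigr => j _; rewrite (DeltaE _ _ x0) //.
(* The positions increase strictly up to [n], so every step of the chain has between 1 and [n]
   boxes, as [DeltaE] asks. *)
have /and3P[_ _ /forallP/(_ j)/andP[_ /eqP->]] := chain_mu.
rewrite subn_gt0 (Sn_term_ltS Snl) //=.
by apply: leq_trans (leq_subr _ _) _; exact: Sn_term_leq.
Qed.
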